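(* Let $H>0$ and $S_H=\{z\in\mathbb{C}:\,|\operatorname{Im} z|\le H\}$. Let $\mu$ be a measure with support in $S_H$ which is either (a) positive and satisfies $\mu(\{z\in S_H:\,|\operatorname{Re} z|\le r\})\le C_0\max\{1,r^\rho\}$ for all $r>0$ with some positive constants $C_0,\rho$, or (b) a complex measure that is translation bounded on $S_H$, i.e. $\sup_{s\in\mathbb{R}}|\mu|(\{z\in S_H:\,s\le\operatorname{Re} z\le s+1\})<\infty$. Suppose that the c-Fourier transform of $\mu$ is a pure point measure $\hat\mu^c=\sum_{\gamma\in\Gamma}b_\gamma\delta_\gamma$. Then the measure $\nu=\sum_{\gamma\in\Gamma}|b_\gamma|^2\delta_\gamma$ satisfies $$\nu(t-1,t+1)=O(e^{4\pi H|t|})\quad\text{as } t\to\infty,$$ and $\nu$ has type at most $4\pi H$ with respect to exponential growth, i.e. $\limsup_{r\to\infty} r^{-1}\log\nu(-r,r)\le 4\pi H$.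
   Context: $|\mu|$ denotes the variation of a complex measure. For $\varphi\in L^1(\mathbb{R})$ with compact support, $\hat\varphi^c(z)=\int_{\mathbb{R}}\varphi(t)e^{-2\pi i z t}\,dt$, $z\in\mathbb{C}$. Let $\mathcal{D}$ be the space of $C^\infty$ compactly supported functions on $\mathbb{R}$. For a measure $\mu$ on $S_H$ with $|\mu|(\{z\in S_H:|\operatorname{Re} z|\le r\})\le C\max\{1,r^\rho\}$ (which holds for translation bounded measures with $\rho=1$), the c-Fourier transform $\hat\mu^c$ is the functional on $\mathcal{D}$ given by $(\hat\mu^c,\varphi)=\int_{S_H}\hat\varphi^c(z)\,\mu(dz)$. ''$\hat\mu^c$ is a pure point measure $\sum_{\gamma\in\Gamma}b_\gamma\delta_\gamma$'' means $\Gamma\subset\mathbb{R}$ is countable, $b_\gamma\in\mathbb{C}$, $\sum_{\gamma\in\Gamma\cap K}|b_\gamma|<\infty$ for every compact $K$, and $(\hat\mu^c,\varphi)=\sum_\gamma b_\gamma\varphi(\gamma)$ for all $\varphi\in\mathcal{D}$; $\delta_\gamma$ is the unit mass at $\gamma$. *)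

(* Defs.v *)
From HB Require Import structures.
From mathcomp Require Import all_boot all_order all_algebra.
From mathcomp Require Import all_classical all_reals all_analysis.
From mathcomp Require Import complex.
Set Implicit Arguments. Unset Strict Implicit. Unset Printing Implicit Defensive.
Import Order.TTheory GRing.Theory Num.Theory.
Import numFieldNormedType.Exports.
Local Open Scope classical_set_scope.
Local Open Scope ring_scope.

Section Defs.
Variable R : realType.

Definition rsum (T : choiceType) (D : set T) (f : T -> R) : R :=
  fine (\esum_(i in D) ((f^\+ i)%:E)) - fine (\esum_(i in D) ((f^\- i)%:E)).

Definition csum (T : choiceType) (D : set T) (f : T -> R[i]) : R[i] :=
  Complex (rsum D (fun i => complex.Re (f i))) (rsum D (fun i => complex.Im (f i))).

Definition cint (d : measure_display) (T : measurableType d)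
  (mu : {measure set T -> \bar R}) (f : T -> R[i]) : R[i] :=
  Complex (Rintegral mu setT (fun x => complex.Re (f x)))
          (Rintegral mu setT (fun x => complex.Im (f x))).

(* e^{-2 pi i z t} for z = x + i y *)
Definition cexpc (x y t : R) : R[i] :=
  Complex (expR (2 * pi * y * t) * cos (2 * pi * x * t))
          (- (expR (2 * pi * y * t) * sin (2 * pi * x * t))).

Definition fourier_c (phi : R -> R[i]) (x y : R) : R[i] :=
  cint (@lebesgue_measure R) (fun t => phi t * cexpc x y t).

Definition smooth (f : R -> R) : Prop :=
  forall (n : nat) (x : R), derivable (iter n (fun g : R -> R => derive1 g) f) x 1.

Definition test_fun (phi : R -> R[i]) : Prop :=
  [/\ smooth (fun t => complex.Re (phi t)), smooth (fun t => complex.Im (phi t)) &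
     exists M : R, forall t, M < `|t| -> phi t = 0].

Definition nu (Gamma : set R) (b : R -> R[i]) (A : set R) : \bar R :=
  (\esum_(g in Gamma `&` A) ((Normc.normc (b g)) ^+ 2)%:E)%E.

End Defs.

(* Main.v *)
Require Import Defs.
From HB Require Import structures.
From mathcomp Require Import all_boot all_order all_algebra.
From mathcomp Require Import all_classical all_reals all_analysis.
From mathcomp Require Import complex ring lra measurable_realfun.
Import Order.TTheory GRing.Theory Num.Theory.
Import numFieldNormedType.Exports.
Local Open Scope classical_set_scope.
Local Open Scope ring_scope.
Set Implicit Arguments. Unset Strict Implicit. Unset Printing Implicit Defensive.

(** Fix a bump [psi] with [psi >= 1] on [(-1, 1)]. Testing the transform against
    [psi (x - t) exp (2 i pi u x)] gives the almost periodic function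
    [f u = \sum_g b_g psi (g - t) exp (2 i pi u g)], whose mean square is
    [\sum_g |b_g psi (g - t)|^2 >= nu (t - 1, t + 1)]. On the other side [f u] is the integral
    against [mu] of the transform of [psi (x - t)] translated by [u], which on the strip is
    [O (exp (2 pi H |t|) / (1 + |Re z - u|^2))]; translation boundedness of [mu] then bounds
    [f] by [C exp (2 pi H |t|)].

    A positive [mu] of polynomial growth is translation bounded. There is a test function,
    with support so small that the strip looks thin, whose transform on the strip has real
    part at least [1/2] for [|Re z| <= l] and at least [- kap / (1 + (L0 Re z / l)^2)^n]
    everywhere, with [kap] small. Since the tested values are bounded in [u], the mass [M s]
    of [s <= Re z <= s + l] is bounded by a constant plus a small multiple of a weighted sum
    of translates of [M]. From [M s <= D + a (1 + |s| / l)^q] one thus gets the same bound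
    with [a / 2] instead of [a], and so [M <= D]. *)

(** In case (a) the growth hypothesis alone bounds [f u] only by a power of [|u|], from which no
    finite mean square follows; hence the detour through translation boundedness. The natural tool
    is a kernel with positive transform, but positivity comes for free on the real line only, where
    a transform can be made a square. The two departures from it, a Riemann sum in place of an
    autocorrelation and a thin strip in place of the line, leave a negative part. It is weighed
    against far mass, so it must decay faster than that mass can grow.

    The order of the choices matters. The radius [L0] comes from the bump alone. Lengths are counted
    in units of [l = L0 / eps], so the constant [K] of the weighted sum depends only on [L0] and the
    growth exponent. Then [kap = 1 / (4 K)] is fixed, and only then the kernel, with its [eps] and
    [l]. The growth hypothesis supplies the finite bound from which the absorption starts; an
    inequality that bounds masses by a fraction of themselves says nothing of infinite ones. *)

(** * Smooth functions *)

Section Smooth.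
Variable R : realType.
Implicit Types f g : R -> R.

(** Smoothness as a coinductive property: a class of functions closed under differentiation consists
    of smooth functions. Each use below picks such a class, so no closed form of an iterated
    derivative is ever written. *)
Lemma smooth_coind (P : (R -> R) -> Prop) :
  (forall f, P f -> exists2 f', (forall x : R, is_derive x 1 f (f' x)) & P f') ->
  forall f, P f -> smooth f.
Proof.
move=> HP f Pf.
suff Pn n : P (iter n (fun g : R -> R => derive1 g) f).
  by move=> n x; have [f' df' _] := HP _ (Pn n); exact: ex_derive.
elim: n => //= n /HP[f' df' Pf'].
suff -> : derive1 (iter n (fun g : R -> R => derive1 g) f) = f' by [].
by apply/funext => x; rewrite derive1E; apply: derive_val.
Qed.

Lemma smooth_is_derive f : smooth f -> forall x : R, is_derive x 1 f (derive1 f x).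
Proof.
by move=> sf x; rewrite derive1E; apply: derivableP; exact: (sf 0%N x).
Qed.

Lemma smooth_derive1 f : smooth f -> smooth (derive1 f).
Proof. by move=> sf n x; have := sf n.+1 x; rewrite iterSr. Qed.

Lemma smooth_continuous f : smooth f -> continuous f.
Proof.
move=> sf x; apply/differentiable_continuous/derivable1_diffP.
exact: (sf 0%N x).
Qed.

(** By the Leibniz rule, products of smooth functions are not closed under differentiation, but sums
    of products are. This closure is the class to which [smooth_coind] applies. *)
Inductive smooth_alg : (R -> R) -> Prop :=
| smooth_alg_base f : smooth f -> smooth_alg f
| smooth_alg_add f g : smooth_alg f -> smooth_alg g -> smooth_alg (fun t => f t + g t)
| smooth_alg_mul f g : smooth_alg f -> smooth_alg g -> smooth_alg (fun t => f t * g t).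

Lemma smooth_alg_smooth f : smooth_alg f -> smooth f.
Proof.
move: f; apply: smooth_coind => f; elim=> {f} [f sf|f g _ [f' df sf'] _ [g' dg sg']|
    f g sf [f' df sf'] sg [g' dg sg']].
- by exists (derive1 f); [exact: smooth_is_derive|apply/smooth_alg_base/smooth_derive1].
- exists (fun t => f' t + g' t); last exact: smooth_alg_add.
  by move=> x; have := df x; have := dg x => *; exact: is_deriveD.
- exists (fun t => f t * g' t + g t * f' t).
    by move=> x; have := df x; have := dg x => *; exact: is_deriveM.
  by apply: smooth_alg_add; apply: smooth_alg_mul.
Qed.

Lemma smoothD f g : smooth f -> smooth g -> smooth (fun t => f t + g t).
Proof.
by move=> sf sg; apply/smooth_alg_smooth/smooth_alg_add; exact: smooth_alg_base.
Qed.

Lemma smoothM f g : smooth f -> smooth g -> smooth (fun t => f t * g t).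
Proof.
by move=> sf sg; apply/smooth_alg_smooth/smooth_alg_mul; exact: smooth_alg_base.
Qed.

Lemma smooth_cst (c : R) : smooth (fun _ : R => c).
Proof.
apply: (@smooth_coind (fun f => exists c, f = fun=> c)); last by exists c.
by move=> _ [k ->]; exists (fun=> 0); [move=> x; exact: is_derive_cst|exists 0].
Qed.

Lemma smooth_sum (I : Type) (r : seq I) (F : I -> R -> R) :
  (forall i, smooth (F i)) -> smooth (fun t => \sum_(i <- r) F i t).
Proof.
move=> sF; elim: r => [|i r IH].
  by under eq_fun do rewrite big_nil; exact: smooth_cst.
by under eq_fun do rewrite big_cons; exact: smoothD.
Qed.

Lemma is_derive_affine (a b x : R) : is_derive x 1 (fun t : R => a * t + b) a.
Proof.
by apply: is_derive_eq; rewrite ?scaler0 !addr0 /GRing.scale /= ?mulr1 ?mul0r ?addr0.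
Qed.

Lemma smooth_affine (a b : R) : smooth (fun t : R => a * t + b).
Proof.
apply: (@smooth_coind (fun f => exists a b, f = fun t => a * t + b)); last by exists a, b.
move=> _ {a b} [a [b ->]]; exists (fun=> a); first by move=> x; exact: is_derive_affine.
by exists 0, a; apply/funext => t; rewrite mul0r add0r.
Qed.

Lemma smoothX f n : smooth f -> smooth (fun t => f t ^+ n).
Proof.
move=> sf; elim: n => [|n IH].
  by under eq_fun do rewrite expr0; exact: smooth_cst.
by under eq_fun do rewrite exprS; exact: smoothM.
Qed.

Lemma is_derive_comp_affine f (f' : R -> R) (a b x : R) :
  (forall t : R, is_derive t 1 f (f' t)) ->
  is_derive x 1 (fun t : R => f (a * t + b)) (a * f' (a * x + b)).
Proof.
move=> df; have H1 := is_derive_affine a b x; have H2 := df (a * x + b).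
by rewrite [a * f' _]mulrC; exact: (@is_derive1_comp _ f (fun t : R => a * t + b)).
Qed.

Lemma smooth_comp_affine f (a b : R) : smooth f -> smooth (fun t => f (a * t + b)).
Proof.
move=> sf; apply: (@smooth_coind (fun g => exists c f,
  smooth f /\ g = fun t => c * f (a * t + b))); last first.
  by exists 1, f; split => //; apply/funext => t; rewrite mul1r.
move=> {f sf} _ [c [f [sf ->]]].
exists (fun t => c * a * derive1 f (a * t + b)); last first.
  by exists (c * a), (derive1 f); split => //; exact: smooth_derive1.
move=> x; have H1 := is_derive_comp_affine a b x (smooth_is_derive sf).
by apply: is_derive_eq; rewrite /GRing.scale /=; ring.
Qed.

Lemma is_derive_cosM (w x : R) :
  is_derive x 1 (fun t : R => cos (w * t)) (- (w * sin (w * x))).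
Proof.
have := @is_derive_comp_affine cos (fun t => - sin t) w 0 x (@is_derive_cos R).
by under eq_fun do rewrite addr0; rewrite addr0 mulrN.
Qed.

Lemma is_derive_sinM (w x : R) :
  is_derive x 1 (fun t : R => sin (w * t)) (w * cos (w * x)).
Proof.
have := @is_derive_comp_affine sin cos w 0 x (@is_derive_sin R).
by under eq_fun do rewrite addr0; rewrite addr0.
Qed.

Lemma smooth_cos_sin (w a b : R) : smooth (fun t : R => a * cos (w * t) + b * sin (w * t)).
Proof.
apply: (@smooth_coind (fun f => exists a b, f = fun t => a * cos (w * t) + b * sin (w * t))).
  move=> _ {a b} [a [b ->]].
  exists (fun t => (b * w) * cos (w * t) + (- (a * w)) * sin (w * t)); last by do 2 eexists.
  move=> x; have H1 := is_derive_cosM w x; have H2 := is_derive_sinM w x.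
  by apply: is_derive_eq; rewrite /GRing.scale /=; ring.
by exists a, b.
Qed.

Lemma smooth_cosM (w : R) : smooth (fun t : R => cos (w * t)).
Proof.
have := @smooth_cos_sin w 1 0; congr smooth.
by apply/funext => t; rewrite mul1r mul0r addr0.
Qed.

Lemma smooth_sinM (w : R) : smooth (fun t : R => sin (w * t)).
Proof.
have := @smooth_cos_sin w 0 1; congr smooth.
by apply/funext => t; rewrite mul1r mul0r add0r.
Qed.


(* The derivatives of [exp (- 1 / x)] stay in this family, which vanishes to all orders
   at 0. *)
Definition flat (p : {poly R}) (x : R) : R :=
  if 0 < x then p.[x^-1] * expR (- x^-1) else 0.

Lemma horner_le_exp (p : {poly R}) (u : R) : 1 <= u ->
  `|p.[u]| <= (\sum_(i < size p) `|p`_i|) * u ^+ size p.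
Proof.
move=> u1; rewrite horner_coef mulr_suml; apply: (le_trans (ler_norm_sum _ _ _)).
apply: ler_sum => i _; rewrite normrM ler_wpM2l// normrX ger0_norm; last lra.
by apply: ler_weXn2l => //; exact: ltnW.
Qed.

(** With [u = 1 / x >= 1], [p] is at most a multiple of [u ^+ n], while [expR u] dominates
    [u ^+ n.+2 / (n.+2)!]; the two spare powers give [x ^+ 2]. *)
Lemma flat_le_sqr (p : {poly R}) :
  exists C : R, forall x, `|x| <= 1 -> `|flat p x| <= C * x ^+ 2.
Proof.
set n := size p; set S := \sum_(i < size p) `|p`_i|.
have S0 : 0 <= S by apply: sumr_ge0.
exists (S * (n.+2)`!%:R) => x x1; rewrite /flat; case: ifPn => [x0|_]; last first.
  by rewrite normr0 mulr_ge0 ?sqr_ge0// mulr_ge0.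
have u0 : 0 < x^-1 by rewrite invr_gt0.
have u1 : 1 <= x^-1 by rewrite invf_ge1 // -(gtr0_norm x0).
rewrite normrM (gtr0_norm (expR_gt0 _)) expRN ler_pdivrMr ?expR_gt0//.
apply: (le_trans (horner_le_exp p u1)); rewrite -/S -!mulrA ler_wpM2l//.
have := expR_ge1Dxn n.+1 (ltW u0).
set e := expR _ => he.
have : x^-1 ^+ n.+2 <= (n.+2)`!%:R * e.
  rewrite mulrC -ler_pdivrMr ?ltr0n ?fact_gt0//; apply: le_trans he; lra.
rewrite -/n => he2.
suff -> : x^-1 ^+ n = x ^+ 2 * x^-1 ^+ n.+2.
  have -> : (n.+2)`!%:R * (x * (x * e)) = x ^+ 2 * ((n.+2)`!%:R * e) by ring.
  by rewrite ler_wpM2l ?sqr_ge0.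
rewrite (exprS _ n.+1) (exprS _ n); move: (x^-1 ^+ n) => v.
by field; rewrite gt_eqF.
Qed.

Lemma is_derive_flat0 (f : R -> R) (C : R) : f 0 = 0 ->
  (forall x, `|x| <= 1 -> `|f x| <= C * x ^+ 2) -> is_derive (0 : R) 1 f 0.
Proof.
move=> f0 Hf.
have H : (fun h : R => h^-1 *: ((f \o shift 0) (h *: 1) - f 0)) @ 0^' --> (0 : R).
  have C0 : 0 <= C.
    have := Hf 1; rewrite normr1 expr1n mulr1 lexx => /(_ isT).
    by apply: le_trans.
  apply/cvgr0Pnorm_le => e e0; near=> h.
  have h0 : h != 0 by near: h; exact: nbhs_dnbhs_neq.
  have h1 : `|h| <= 1.
    by near: h; exact: dnbhs0_le.
  have he : `|h| <= e / (C + 1).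
    by near: h; apply: dnbhs0_le; rewrite divr_gt0//; lra.
  rewrite /= f0 subr0 /shift /= addr0 /GRing.scale /= mulr1 normrM normfV.
  rewrite mulrC ler_pdivrMr ?normr_gt0//; apply: (le_trans (Hf _ h1)).
  rewrite -[h ^+ 2]real_normK ?num_real// expr2 mulrA ler_wpM2r//.
  rewrite ler_pdivlMr in he; last lra.
  by apply: le_trans he; rewrite mulrC ler_wpM2l//; lra.
apply: DeriveDef; first by apply/cvg_ex; exists 0.
exact: cvg_lim H.
Unshelve. all: by end_near. Qed.

Lemma is_derive_flat (p : {poly R}) (x : R) :
  is_derive x 1 (flat p) (flat ('X ^+ 2 * (p - p^`())%R) x).
Proof.
have [x0|x0|->] := ltgtP x 0.
- have -> : flat ('X ^+ 2 * (p - p^`())%R) x = 0 by rewrite /flat ltNge (ltW x0).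
  apply: (@near_eq_is_derive _ _ _ (fun=> 0)).
  near=> y; rewrite /flat; suff: y < 0 by move=> y0; rewrite ltNge (ltW y0).
  by near: y; exact: lt_nbhsl.
- have -> : flat ('X ^+ 2 * (p - p^`())%R) x =
      ('X ^+ 2 * (p - p^`())%R).[x^-1] * expR (- x^-1) by rewrite /flat x0.
  have dV : is_derive x 1 (fun y : R => y^-1) (- x ^- 2).
    have x0' : x != 0 by rewrite gt_eqF.
    apply: DeriveDef; first by apply: (@derivableV _ _ id).
    by rewrite (@deriveV _ _ id)// derive_id /GRing.scale /= mulr1.
  have dp : is_derive (x^-1) 1 (horner p) (p^`()).[x^-1].
    apply: DeriveDef; first exact: derivable_horner.
    by rewrite -derive1E -derivE.
  have d1 := is_derive1_comp dp dV.
  have dN : is_derive x 1 (fun y : R => - y^-1) (x ^- 2).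
    by apply: is_derive_eq; rewrite opprK.
  have d2 := @is_derive1_comp _ expR (fun y => - y^-1) _ _ _ (is_derive_expR _) dN.
  have D : is_derive x 1 (fun y => p.[y^-1] * expR (- y^-1))
      (('X ^+ 2 * (p - p^`())%R).[x^-1] * expR (- x^-1)).
    have := is_deriveM d1 d2; congr is_derive.
    rewrite /GRing.scale /= hornerM hornerXn hornerD hornerN.
    by field; rewrite gt_eqF.
  apply: (near_eq_is_derive _ D).
  near=> y; rewrite /flat; suff: 0 < y by move=> ->.
  by near: y; exact: lt_nbhsr.
- have -> : flat ('X ^+ 2 * (p - p^`())%R) 0 = 0 by rewrite /flat ltxx.
  have [C HC] := flat_le_sqr p.
  by apply: is_derive_flat0 HC; rewrite /flat ltxx.
Unshelve. all: by end_near. Qed.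

Lemma smooth_flat (p : {poly R}) : smooth (flat p).
Proof.
apply: (@smooth_coind (fun f => exists p, f = flat p)); last by exists p.
move=> _ {p} [p ->]; eexists; first by move=> x; exact: is_derive_flat.
by eexists.
Qed.

Lemma is_derive_expRM (w x : R) :
  is_derive x 1 (fun t : R => expR (w * t)) (w * expR (w * x)).
Proof.
have := @is_derive_comp_affine expR expR w 0 x (@is_derive_expR R).
by under eq_fun do rewrite addr0; rewrite addr0.
Qed.

Lemma smooth_expRM (w : R) : smooth (fun t : R => expR (w * t)).
Proof.
apply: (@smooth_coind (fun f => exists c, f = fun t => c * expR (w * t))); last first.
  by exists 1; apply/funext => t; rewrite mul1r.
move=> _ [c ->]; exists (fun t => (c * w) * expR (w * t)); last by eexists.
move=> x; have H := is_derive_expRM w x.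
by apply: is_derive_eq; rewrite /GRing.scale /=; ring.
Qed.

Lemma smooth_bump : exists psi : R -> R,
  [/\ smooth psi, (forall t, 0 <= psi t), (forall t, `|t| < 1 -> 1 <= psi t)
    & (forall t, 2 < `|t| -> psi t = 0)].
Proof.
pose g := flat 1.
have g0 t : 0 <= g t by rewrite /g /flat; case: ifP => // _; rewrite hornerE mul1r expR_ge0.
have g1 t : 1 <= t -> expR (- 1) <= g t.
  move=> t1; rewrite /g /flat (lt_le_trans ltr01 t1) hornerE mul1r ler_expR lerN2.
  by rewrite invf_le1//; lra.
(* For [|t| < 1] both arguments exceed 1, so each factor is at least [expR (- 1)]; [expR 2]
   normalises the product. *)
exists (fun t => expR 2 * (g (1 * t + 2) * g (- 1 * t + 2))); split.
- apply: smoothM; first exact: smooth_cst.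
  by apply: smoothM; apply: smooth_comp_affine; exact: smooth_flat.
- by move=> t; rewrite mulr_ge0 ?expR_ge0 ?mulr_ge0.
- move=> t; rewrite ltr_norml => /andP[t1 t2].
  have E : 1 = expR 2 * (expR (- 1) * expR (- 1)) :> R.
    by rewrite -expRD -expRD (_ : 2 + _ = 0) ?expR0//; ring.
  rewrite [leLHS]E ler_wpM2l ?expR_ge0//.
  by apply: ler_pM; rewrite ?expR_ge0//; apply: g1; lra.
- move=> t; rewrite lter_normr => /orP[t2|t2].
    by rewrite [g (- 1 * t + 2)]/g /flat (_ : 0 < - 1 * t + 2 = false) ?mulr0//; lra.
  by rewrite [g (1 * t + 2)]/g /flat (_ : 0 < 1 * t + 2 = false) ?mul0r ?mulr0//; lra.
Qed.

End Smooth.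

(** * Integrals of compactly supported functions *)

Section CompactIntegral.
Variable R : realType.
Implicit Types f g F : R -> R.
Local Notation mu := (@lebesgue_measure R).

Definition supp_in (a b : R) f := forall t, (t < a) || (b < t) -> f t = 0.

Lemma restrict_supp_in (a b : R) f : supp_in a b f -> f \_ `[a, b]%classic = f.
Proof.
move=> sf; apply/funext => t; rewrite patchE; case: ifPn => // /negP.
rewrite inE /= in_itv /= => /negP; rewrite negb_and -!ltNge => tab.
by rewrite sf.
Qed.

Lemma Rintegral_supp_in (a b : R) f : supp_in a b f ->
  \int[mu]_t f t = \int[mu]_(t in `[a, b]) f t.
Proof. by move=> sf; rewrite [RHS]Rintegral_mkcond restrict_supp_in. Qed.

Lemma integrable_supp_in (a b : R) f : continuous f -> supp_in a b f ->
  mu.-integrable setT (EFin \o f).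
Proof.
move=> cf sf; rewrite -(restrict_supp_in sf) -restrict_EFin.
suff: mu.-integrable `[a, b] (EFin \o f).
  by move/integrable_mkcond; apply; exact: measurable_itv.
apply: continuous_compact_integrable; first exact: segment_compact.
exact: continuous_subspaceT.
Qed.

Lemma continuous_is_derive F f :
  (forall x : R, is_derive x 1 F (f x)) -> continuous F.
Proof.
move=> dF x; apply/differentiable_continuous/derivable1_diffP.
exact: ex_derive.
Qed.

Lemma Rintegral_FTC (a b : R) f F : a < b -> continuous f -> supp_in a b f ->
  (forall x : R, is_derive x 1 F (f x)) -> \int[mu]_t f t = F b - F a.
Proof.
move=> ab cf sf dF; rewrite (Rintegral_supp_in sf) /Rintegral.
have cF := continuous_is_derive dF.
rewrite (@continuous_FTC2 _ f F) //.
- exact: continuous_subspaceT.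
- split => [x _||]; first exact: ex_derive.
    exact/cvg_at_right_filter/cF.
  exact/cvg_at_left_filter/cF.
- by move=> x _; rewrite derive1E; exact: derive_val.
Qed.

Lemma ex_antiderivative (a b : R) f : continuous f -> supp_in a b f ->
  exists F, forall x : R, is_derive x 1 F (f x).
Proof.
move=> cf sf; pose F x := \int[mu]_(t in `]-oo, x]) f t.
exists F => x; have := @continuous_FTC1 R f -oo%O x (x + 1).
rewrite ltrDl ltr01 => /(_ isT); case.
- by apply: integrableS (integrable_supp_in cf sf).
- by rewrite ltNyr.
- exact: cf.
- by move=> dF <-; rewrite derive1E; exact: derivableP.
Qed.

(** If [F] is a primitive of [f], then [c^-1 * F (c * t + d)] is one of the integrand, so both sides
    are increments of [F]. *)
Lemma Rintegral_affine (a b c d : R) f : a < b -> continuous f -> supp_in a b f ->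
  0 < c -> \int[mu]_t f (c * t + d) = c^-1 * \int[mu]_t f t.
Proof.
move=> ab cf sf c0; have [F dF] := ex_antiderivative cf sf.
rewrite (Rintegral_FTC ab cf sf dF).
have cn0 : c != 0 by rewrite gt_eqF.
have dG (x : R) : is_derive x 1 (fun t => c^-1 * F (c * t + d)) (f (c * x + d)).
  have H := is_derive_comp_affine c d x dF.
  by apply: is_derive_eq; rewrite /GRing.scale /=; field.
rewrite (@Rintegral_FTC ((a - d) / c) ((b - d) / c) _ _ _ _ _ dG).
- by rewrite ![c * (_ / c)]mulrC !divfK// !subrK mulrBr.
- by rewrite ltr_pM2r ?invr_gt0// ltrD2r.
- move=> x; apply: (@continuous_comp _ _ _ (fun t => c * t + d) f); last exact: cf.
  by apply: (@continuous_is_derive _ (fun=> c)) => y; exact: is_derive_affine.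
- move=> t tab; apply: sf; move: tab.
  by rewrite ltr_pdivlMr// ltr_pdivrMr// ltrBrDr ltrBlDr mulrC.
Qed.

Lemma Rintegral_le_norm (a b c : R) f : a <= b -> continuous f -> supp_in a b f ->
  (forall t, a <= t <= b -> `|f t| <= c) -> `|\int[mu]_t f t| <= c * (b - a).
Proof.
move=> ab cf sf fc; rewrite (Rintegral_supp_in sf).
have fi : mu.-integrable `[a, b] (EFin \o f).
  by apply: integrableS (integrable_supp_in cf sf).
apply: (le_trans (le_normr_Rintegral _ fi)) => //.
have -> : c * (b - a) = \int[mu]_(t in `[a, b]) c.
  rewrite Rintegral_cst//= lebesgue_measure_itv /= lte_fin.
  by case: ltP => //= ba; rewrite (@le_anti _ _ a b) ?ab// subrr.
apply: le_Rintegral => //.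
- by apply/integrable_norm.
- apply: continuous_compact_integrable; first exact: segment_compact.
  exact/continuous_subspaceT/cst_continuous.
Qed.

Lemma supp_in_bounded (a b : R) f : continuous f -> supp_in a b f ->
  exists2 c : R, 0 <= c & forall t, `|f t| <= c.
Proof.
move=> cf sf; have [ab|ba] := leP a b; last first.
  exists 0 => // t; rewrite sf ?normr0//.
  by case: ltP => //= ta; exact: lt_le_trans ta.
have cnf : {within `[a, b], continuous (fun t => `|f t|)}.
  by apply: continuous_subspaceT => t; apply: cvg_norm; exact: cf.
have [c _ fc] := EVT_max ab cnf.
exists `|f c| => // t; have [tab|] := boolP (t \in `[a, b]); first exact: fc.
by rewrite in_itv /= negb_and -!ltNge => tab; rewrite sf ?normr0.
Qed.

Lemma integrable_linear (d : measure_display) (T : measurableType d)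
    (m : {measure set T -> \bar R}) (u v : T -> R) (al be : R) :
  m.-integrable setT (EFin \o u) -> m.-integrable setT (EFin \o v) ->
  m.-integrable setT (EFin \o (fun t => al * u t + be * v t)).
Proof.
move=> iu iv.
exact: (integrableD measurableT (integrableZl measurableT al iu) (integrableZl measurableT be iv)).
Qed.

Lemma Rintegral_linear (d : measure_display) (T : measurableType d)
    (m : {measure set T -> \bar R}) (u v : T -> R) (al be : R) :
  m.-integrable setT (EFin \o u) -> m.-integrable setT (EFin \o v) ->
  \int[m]_t (al * u t + be * v t) = al * \int[m]_t u t + be * \int[m]_t v t.
Proof.
move=> iu iv; rewrite RintegralD//; first by rewrite !RintegralZl.
- exact: (integrableZl measurableT al iu).
- exact: (integrableZl measurableT be iv).
Qed.

End CompactIntegral.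

(** * Decay of the transform *)

Section FourierLaplace.
Variable R : realType.
Implicit Types f g F : R -> R.
Local Notation mu := (@lebesgue_measure R).

(* [fcos f x y - i fsin f x y] is the transform of [f] at [x + i y]. *)
Definition coskern (x y t : R) : R := expR (2 * pi * y * t) * cos (2 * pi * x * t).
Definition sinkern (x y t : R) : R := expR (2 * pi * y * t) * sin (2 * pi * x * t).
Definition fcos f (x y : R) : R := \int[mu]_t (f t * coskern x y t).
Definition fsin f (x y : R) : R := \int[mu]_t (f t * sinkern x y t).
Definition fsqr f x y := fcos f x y ^+ 2 + fsin f x y ^+ 2.

Lemma smooth_coskern (x y : R) : smooth (coskern x y).
Proof. by apply: smoothM; [exact: smooth_expRM|exact: smooth_cosM]. Qed.

Lemma smooth_sinkern (x y : R) : smooth (sinkern x y).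
Proof. by apply: smoothM; [exact: smooth_expRM|exact: smooth_sinM]. Qed.

Lemma coskern_le (x y t : R) : `|coskern x y t| <= expR (2 * pi * y * t).
Proof.
rewrite /coskern normrM (gtr0_norm (expR_gt0 _)) ler_piMr ?expR_ge0//.
by rewrite ler_norml cos_geN1 cos_le1.
Qed.

Lemma sinkern_le (x y t : R) : `|sinkern x y t| <= expR (2 * pi * y * t).
Proof.
rewrite /sinkern normrM (gtr0_norm (expR_gt0 _)) ler_piMr ?expR_ge0//.
by rewrite ler_norml sin_geN1 sin_le1.
Qed.

Lemma is_derive_coskern (x y t : R) : is_derive t 1 (coskern x y)
  (2 * pi * (y * coskern x y t - x * sinkern x y t)).
Proof.
have H1 := is_derive_expRM (2 * pi * y) t; have H2 := is_derive_cosM (2 * pi * x) t.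
have := is_deriveM H1 H2; congr is_derive.
by rewrite /GRing.scale /= /coskern /sinkern; ring.
Qed.

Lemma is_derive_sinkern (x y t : R) : is_derive t 1 (sinkern x y)
  (2 * pi * (y * sinkern x y t + x * coskern x y t)).
Proof.
have H1 := is_derive_expRM (2 * pi * y) t; have H2 := is_derive_sinM (2 * pi * x) t.
have := is_deriveM H1 H2; congr is_derive.
by rewrite /GRing.scale /= /coskern /sinkern; ring.
Qed.

Lemma continuous_mulf f g : continuous f -> continuous g -> continuous (fun t => f t * g t).
Proof. by move=> cf cg x; apply: cvgM; [exact: cf|exact: cg]. Qed.

Lemma supp_inMr (a b : R) f g : supp_in a b f -> supp_in a b (fun t => f t * g t).
Proof. by move=> sf t /sf ->; rewrite mul0r. Qed.

Lemma integrable_mul_supp (a b : R) f g : continuous f -> supp_in a b f -> continuous g ->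
  mu.-integrable setT (EFin \o (fun t => f t * g t)).
Proof.
move=> cf sf cg; apply: (@integrable_supp_in _ a b); last exact: supp_inMr.
exact: continuous_mulf.
Qed.

Lemma supp_in_derive1 (a b : R) f : supp_in a b f -> supp_in a b (derive1 f).
Proof.
move=> sf t tab; rewrite derive1E.
rewrite (@near_eq_derive _ _ _ _ (fun=> 0)) ?derive_cst//.
case/orP: tab => tab; near=> u; apply: sf; apply/orP; [left|right]; near: u.
  exact: lt_nbhsl.
exact: lt_nbhsr.
Unshelve. all: by end_near. Qed.

Lemma supp_inW (a b a' b' : R) f : a' <= a -> b <= b' -> supp_in a b f -> supp_in a' b' f.
Proof.
move=> aa bb sf t /orP[ta|bt]; apply: sf; apply/orP; [left|right].
  exact: lt_le_trans aa.
exact: le_lt_trans bt.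
Qed.

Lemma Rintegral_derive_mul (a b : R) f g (g' : R -> R) : a < b -> smooth f ->
  supp_in a b f -> (forall t : R, is_derive t 1 g (g' t)) -> continuous g' ->
  \int[mu]_t (derive1 f t * g t) = - \int[mu]_t (f t * g' t).
Proof.
move=> ab sf sup dg cg'.
have cf := smooth_continuous sf; have sf' := smooth_derive1 sf.
have cf' := smooth_continuous sf'.
have sup' := supp_in_derive1 sup; have cg := continuous_is_derive dg.
apply/eqP; rewrite eq_sym eqr_oppLR -subr_eq0 opprK; apply/eqP.
rewrite -RintegralD//; last 2 first.
- exact: integrable_mul_supp sup cg'.
- exact: integrable_mul_supp sup' cg.
have dG (t : R) : is_derive t 1 (fun t => f t * g t) (f t * g' t + derive1 f t * g t).
  have df := smooth_is_derive sf t; have := is_deriveM df (dg t).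
  by congr is_derive; rewrite /GRing.scale /=; ring.
(* [supp_in a b f] does not speak of the points [a] and [b] themselves; one unit further out [f]
   vanishes and the boundary terms drop. *)
rewrite (@Rintegral_FTC _ (a - 1) (b + 1) _ _ _ _ _ dG).
- rewrite [f (b + 1)]sup ?[f (a - 1)]sup ?mul0r ?subrr//.
    by rewrite ltrBlDr ltrDl ltr01.
  by rewrite ltrDl ltr01 orbT.
- lra.
- move=> t; apply: cvgD; first exact: (continuous_mulf cf cg').
  exact: (continuous_mulf cf' cg).
- apply: (@supp_inW a b); [lra|lra|].
  by move=> t tab; rewrite sup// sup'// !mul0r addr0.
Qed.

Section IBP.
Variables (a b : R) (f : R -> R).
Hypotheses (ab : a < b) (sf : smooth f) (sup : supp_in a b f).

Lemma integrable_fcos x y : mu.-integrable setT (EFin \o (fun t => f t * coskern x y t)).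
Proof.
apply: integrable_mul_supp sup _; first exact: smooth_continuous.
exact/smooth_continuous/smooth_coskern.
Qed.

Lemma integrable_fsin x y : mu.-integrable setT (EFin \o (fun t => f t * sinkern x y t)).
Proof.
apply: integrable_mul_supp sup _; first exact: smooth_continuous.
exact/smooth_continuous/smooth_sinkern.
Qed.

Lemma fcos_derive1 x y :
  fcos (derive1 f) x y = - (2 * pi * (y * fcos f x y - x * fsin f x y)).
Proof.
have s1 := smooth_continuous (@smooth_coskern x y).
have s2 := smooth_continuous (@smooth_sinkern x y).
rewrite {1}/fcos (Rintegral_derive_mul ab sf sup (is_derive_coskern x y)); last first.
  by move=> t; apply: cvgMr; apply: cvgB; apply: cvgMr; [exact: s1|exact: s2].
congr (- _).
transitivity ((2 * pi * y) * fcos f x y + (- (2 * pi * x)) * fsin f x y); last ring.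
rewrite -Rintegral_linear; [|exact: integrable_fcos|exact: integrable_fsin].
by apply: eq_Rintegral => t _; ring.
Qed.

Lemma fsin_derive1 x y :
  fsin (derive1 f) x y = - (2 * pi * (y * fsin f x y + x * fcos f x y)).
Proof.
have s1 := smooth_continuous (@smooth_coskern x y).
have s2 := smooth_continuous (@smooth_sinkern x y).
rewrite {1}/fsin (Rintegral_derive_mul ab sf sup (is_derive_sinkern x y)); last first.
  by move=> t; apply: cvgMr; apply: cvgD; apply: cvgMr; [exact: s2|exact: s1].
congr (- _).
transitivity ((2 * pi * y) * fsin f x y + (2 * pi * x) * fcos f x y); last ring.
rewrite -Rintegral_linear; [|exact: integrable_fsin|exact: integrable_fcos].
by apply: eq_Rintegral => t _; ring.
Qed.

(** The transform of the derivative is [2 i pi z] times that of [f], with [z = x + i y], and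
    [|2 pi z| >= |x|]. *)
Lemma fsqr_derive1 x y : x ^+ 2 * fsqr f x y <= fsqr (derive1 f) x y.
Proof.
rewrite /fsqr fcos_derive1 fsin_derive1.
have -> : (- (2 * pi * (y * fcos f x y - x * fsin f x y))) ^+ 2 +
   (- (2 * pi * (y * fsin f x y + x * fcos f x y))) ^+ 2 =
   (2 * pi) ^+ 2 * ((x ^+ 2 + y ^+ 2) * (fcos f x y ^+ 2 + fsin f x y ^+ 2)) by ring.
have F0 : 0 <= fcos f x y ^+ 2 + fsin f x y ^+ 2 by rewrite addr_ge0 ?sqr_ge0.
have p1 : 1 <= (2 * pi) ^+ 2 :> R.
  by rewrite expr_ge1//; have := @pi_ge2 R; lra.
apply: (@le_trans _ _ ((x ^+ 2 + y ^+ 2) * (fcos f x y ^+ 2 + fsin f x y ^+ 2))).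
  by rewrite ler_wpM2r// lerDl sqr_ge0.
by rewrite ler_peMl// mulr_ge0// addr_ge0 ?sqr_ge0.
Qed.

End IBP.

Lemma expR_2pi_le (H y t s : R) : `|y| <= H -> `|t| <= s ->
  expR (2 * pi * y * t) <= expR (2 * pi * H * s).
Proof.
move=> yH ts; rewrite ler_expR -!mulrA !ler_pM2l ?pi_gt0//.
by apply: (le_trans (ler_norm _)); rewrite normrM ler_pM.
Qed.

Lemma derive1_shift f (tau t : R) : smooth f ->
  derive1 (fun t => f (t - tau)) t = derive1 f (t - tau).
Proof.
move=> sf; have := is_derive_comp_affine 1 (- tau) t (smooth_is_derive sf).
under eq_fun do rewrite mul1r; rewrite !mul1r => H.
by rewrite [LHS]derive1E; exact: derive_val.
Qed.

Lemma smooth_shift f (tau : R) : smooth f -> smooth (fun t => f (t - tau)).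
Proof.
move=> sf; have := @smooth_comp_affine _ f 1 (- tau) sf.
by under eq_fun do rewrite mul1r.
Qed.

Lemma supp_in_shift (a b tau : R) f : supp_in a b f ->
  supp_in (tau + a) (tau + b) (fun t => f (t - tau)).
Proof.
by move=> sf t tab; apply: sf; rewrite ltrBlDl ltrBrDl.
Qed.

Lemma ler_sqr_norm (u v : R) : `|u| <= v -> u ^+ 2 <= v ^+ 2.
Proof.
move=> uv; rewrite -[u ^+ 2]real_normK ?num_real//.
by rewrite lerXn2r// ?nnegrE//; apply: le_trans uv.
Qed.

Lemma expR_4pi (u v : R) : expR (4 * pi * u * v) = expR (2 * pi * u * v) ^+ 2.
Proof. by rewrite -expRM_natl; congr expR; ring. Qed.

(** Each factor [x ^+ 2] is paid for by one derivative of [f]. On the translated support the kernel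
    is at most [exp (2 pi H (|tau| + M))]; its square is the source of the exponent [4 pi H]. *)
Lemma fsqr_decay (H M : R) (n : nat) f : 0 < M -> smooth f -> supp_in (- M) M f ->
  exists2 C : R, 0 <= C & forall tau x y : R, `|y| <= H ->
    (x ^+ 2) ^+ n * fsqr (fun t => f (t - tau)) x y <= C * expR (4 * pi * H * `|tau|).
Proof.
move=> M0; elim: n f => [|n IH] f sf sup.
  have [c c0 fc] := supp_in_bounded (smooth_continuous sf) sup.
  pose K := c * expR (2 * pi * H * M) * (2 * M).
  exists (2 * K ^+ 2); first by rewrite mulr_ge0 ?sqr_ge0.
  move=> tau x y yH; rewrite expr0 mul1r /fsqr.
  have cft : continuous (fun t => f (t - tau)) by exact/smooth_continuous/smooth_shift.
  have supt := @supp_in_shift _ _ tau _ sup.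
  have bd (k : R -> R -> R -> R) : (forall x y t, `|k x y t| <= expR (2 * pi * y * t)) ->
    continuous (k x y) ->
    (\int[mu]_t (f (t - tau) * k x y t)) ^+ 2 <= K ^+ 2 * expR (4 * pi * H * `|tau|).
    move=> kb ck.
    have -> : K ^+ 2 * expR (4 * pi * H * `|tau|) = (K * expR (2 * pi * H * `|tau|)) ^+ 2.
      by rewrite expR_4pi -exprMn.
    apply: ler_sqr_norm.
    have -> : K * expR (2 * pi * H * `|tau|) =
        c * expR (2 * pi * H * (`|tau| + M)) * ((tau + M) - (tau - M)).
      by rewrite (mulrDr (2 * pi * H)) expRD /K; ring.
    apply: Rintegral_le_norm; [lra|exact: continuous_mulf|exact: supp_inMr|].
    move=> t tab; rewrite normrM ler_pM//; apply: (le_trans (kb _ _ _)).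
    apply: expR_2pi_le => //; rewrite ler_norml.
    by have := ler_norm tau; have := ler_norm (- tau); rewrite normrN; lra.
  rewrite -mulrA mulrDl mul1r; apply: lerD.
    by apply: bd; [exact: coskern_le|exact/smooth_continuous/smooth_coskern].
  by apply: bd; [exact: sinkern_le|exact/smooth_continuous/smooth_sinkern].
have [C C0 HC] := IH _ (smooth_derive1 sf) (supp_in_derive1 sup).
exists C => // tau x y yH; apply: le_trans (HC tau x y yH).
rewrite exprSr -mulrA ler_wpM2l//; first by rewrite exprn_ge0 ?sqr_ge0.
have -> : (fun t => derive1 f (t - tau)) = derive1 (fun t => f (t - tau)).
  by apply/funext => t; rewrite derive1_shift.
have MM : tau - M < tau + M by lra.
exact: (fsqr_derive1 MM (@smooth_shift _ tau sf) (@supp_in_shift _ _ tau _ sup)).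
Qed.

(** The squared modulus of the difference between the transform at [x + i y] and at its projection
    [x] on the real line. *)
Definition fdif f x y := (fcos f x y - fcos f x 0) ^+ 2 + (fsin f x y - fsin f x 0) ^+ 2.

Lemma expR_sub1_le (u : R) : `|expR u - 1| <= `|u| * expR `|u|.
Proof.
have [u0|u0] := leP 0 u.
  have -> : `|expR u - 1| = expR u - 1 by rewrite ger0_norm// subr_ge0 -expR0 ler_expR.
  rewrite (ger0_norm u0) -subr_ge0.
  have := expR_ge1Dx (- u); rewrite expRN => h.
  have := ler_wpM2l (expR_ge0 u) h; rewrite mulfV ?gt_eqF ?expR_gt0//; lra.
have -> : `|expR u - 1| = 1 - expR u.
  by rewrite ler0_norm ?opprB// subr_le0 -expR0 ler_expR ltW.
rewrite (ltr0_norm u0); have := expR_ge1Dx u => h.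
have : - u * 1 <= - u * expR (- u).
  rewrite ler_wpM2l//; first lra.
  by rewrite -[leLHS]expR0 ler_expR; lra.
lra.
Qed.

Lemma Rintegral_mulB f g h (a b : R) : continuous f -> supp_in a b f ->
  continuous g -> continuous h ->
  \int[mu]_t (f t * g t) - \int[mu]_t (f t * h t) = \int[mu]_t (f t * (g t - h t)).
Proof.
move=> cf sf cg ch; rewrite -RintegralB//; last 2 first.
- exact: integrable_mul_supp sf cg.
- exact: integrable_mul_supp sf ch.
by apply: eq_Rintegral => t _; rewrite mulrBr.
Qed.

(** Writing [F] for the transform of [f] and [z = x + i y], passing to the derivative replaces
    [F z - F x] by [2 i pi (z F z - x F x)], that is [2 i pi (x (F z - F x) + i y F z)]. The extra
    term carries the factor [y] and decays by [fsqr_decay]. *)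
Lemma fdif_decay (M : R) (n : nat) f : 0 < M -> smooth f -> supp_in (- M) M f ->
  exists2 C : R, 0 <= C & forall x y : R, `|y| <= 1 ->
    (x ^+ 2) ^+ n * fdif f x y <= C * y ^+ 2.
Proof.
move=> M0; have pi0 := @pi_gt0 R; elim: n f => [|n IH] f sf sup.
  have cf := smooth_continuous sf.
  have [c c0 fc] := supp_in_bounded cf sup.
  pose K := c * (2 * pi * M * expR (2 * pi * M)) * (2 * M).
  exists (2 * K ^+ 2); first by rewrite mulr_ge0 ?sqr_ge0.
  move=> x y y1; rewrite expr0 mul1r /fdif.
  have bd (k : R -> R -> R -> R) (k0 : R -> R) :
    (forall x y t, k x y t = expR (2 * pi * y * t) * k0 (2 * pi * x * t)) ->
    (forall t, `|k0 t| <= 1) -> (forall x y, continuous (k x y)) ->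
    (\int[mu]_t (f t * k x y t) - \int[mu]_t (f t * k x 0 t)) ^+ 2 <= K ^+ 2 * y ^+ 2.
    move=> kE k01 ck; rewrite -exprMn -[(K * y) ^+ 2]real_normK ?num_real//.
    apply: ler_sqr_norm; rewrite (Rintegral_mulB cf sup)// normrM (@ger0_norm _ K); last first.
      by rewrite !mulr_ge0 ?expR_ge0// ltW.
    have -> : K * `|y| = c * (2 * pi * M * `|y| * expR (2 * pi * M)) * (M - - M).
      by rewrite /K; ring.
    apply: Rintegral_le_norm; first lra.
    - apply: continuous_mulf => // t; apply: cvgB; exact: ck.
    - exact: supp_inMr.
    move=> t tM; rewrite normrM ler_pM// !kE -mulrBl mulr0 mul0r expR0 normrM.
    rewrite -[leRHS]mulr1 ler_pM//; apply: (le_trans (expR_sub1_le _)).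
    have tM' : `|t| <= M by rewrite ler_norml; lra.
    have E : `|2 * pi * y * t| <= 2 * pi * M * `|y|.
      rewrite !normrM normr_nat (gtr0_norm pi0) -!mulrA !ler_pM2l//.
      by rewrite mulrC ler_wpM2r.
    apply: ler_pM => //.
    rewrite ler_expR; apply: (le_trans E).
    by rewrite ler_piMr// !mulr_ge0// ltW.
  rewrite -mulrA mulrDl mul1r; apply: lerD.
    apply: (bd _ cos) => //; first by move=> t; rewrite ler_norml cos_geN1 cos_le1.
    by move=> x' y'; exact/smooth_continuous/smooth_coskern.
  apply: (bd _ sin) => //; first by move=> t; rewrite ler_norml sin_geN1 sin_le1.
  by move=> x' y'; exact/smooth_continuous/smooth_sinkern.
have [C C0 HC] := IH _ (smooth_derive1 sf) (supp_in_derive1 sup).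
have [D D0 HD] := fsqr_decay 1 n M0 sf sup.
exists (C + 2 * D); first by rewrite addr_ge0// mulr_ge0.
move=> x y y1.
have MM : - M < M by lra.
(* This is [|w1 + w2|^2 <= 2 |w1|^2 + 2 |w2|^2], where [(2 pi)^2 >= 2] absorbs the first factor
   2. *)
have key : x ^+ 2 * fdif f x y <= fdif (derive1 f) x y + 2 * (y ^+ 2 * fsqr f x y).
  rewrite /fdif /fsqr !(fcos_derive1 MM sf sup) !(fsin_derive1 MM sf sup).
  move: (fcos f x y) (fsin f x y) (fcos f x 0) (fsin f x 0) => A B A0 B0.
  rewrite !mul0r !sub0r !add0r.
  set p := 2 * pi.
  have p1 : 2 <= p ^+ 2 by rewrite /p expr2; have := @pi_ge2 R; nra.
  set u := - (p * (y * A - x * B)) - - (p * - (x * B0)).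
  set v := - (p * (y * B + x * A)) - - (p * (x * A0)).
  have hu : p * (x * (B - B0)) = u + p * (y * A) by rewrite /u; ring.
  have hv : p * (x * (A - A0)) = - v - p * (y * B) by rewrite /v; ring.
  have E : p ^+ 2 * (x ^+ 2 * ((A - A0) ^+ 2 + (B - B0) ^+ 2)) <=
    2 * (u ^+ 2 + v ^+ 2) + 2 * p ^+ 2 * (y ^+ 2 * (A ^+ 2 + B ^+ 2)).
    have -> : p ^+ 2 * (x ^+ 2 * ((A - A0) ^+ 2 + (B - B0) ^+ 2)) =
      (p * (x * (A - A0))) ^+ 2 + (p * (x * (B - B0))) ^+ 2 by ring.
    rewrite hu hv -subr_ge0.
    have -> : 2 * (u ^+ 2 + v ^+ 2) + 2 * p ^+ 2 * (y ^+ 2 * (A ^+ 2 + B ^+ 2)) -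
      ((- v - p * (y * B)) ^+ 2 + (u + p * (y * A)) ^+ 2) =
      (v - p * (y * B)) ^+ 2 + (u - p * (y * A)) ^+ 2 by ring.
    by rewrite addr_ge0 ?sqr_ge0.
  have p0 : 0 < p ^+ 2 by lra.
  rewrite -(ler_pM2l p0); apply: (le_trans E).
  rewrite [leRHS]mulrDr lerD//; last by rewrite le_eqVlt; apply/orP; left; apply/eqP; ring.
  by rewrite ler_wpM2r// addr_ge0 ?sqr_ge0.
rewrite exprSr -mulrA.
apply: (@le_trans _ _ ((x ^+ 2) ^+ n * (fdif (derive1 f) x y + 2 * (y ^+ 2 * fsqr f x y)))).
  by rewrite ler_wpM2l// exprn_ge0 ?sqr_ge0.
rewrite (mulrDr ((x ^+ 2) ^+ n)) (mulrDl C) lerD//; first exact: HC.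
have := HD 0 x y y1; rewrite normr0 mulr0 expR0 mulr1.
under [fun t => f (t - 0)]eq_fun do rewrite subr0.
move=> h; have := ler_wpM2l (sqr_ge0 y) h.
have -> : (x ^+ 2) ^+ n * (2 * (y ^+ 2 * fsqr f x y)) =
  2 * (y ^+ 2 * ((x ^+ 2) ^+ n * fsqr f x y)) by ring.
lra.
Qed.

(** [1 + x ^+ 2] is at most 2 or at most [2 * x ^+ 2], according to whether [x ^+ 2 <= 1]; the first
    bound serves in one case, the second in the other. *)
Lemma weight_le (N a b x : R) (k : nat) : 0 <= N -> N <= a -> (x ^+ 2) ^+ k * N <= b ->
  (1 + x ^+ 2) ^+ k * N <= 2 ^+ k * (a + b).
Proof.
move=> N0 Na Nb; have x0 := sqr_ge0 x.
have b0 : 0 <= b by apply: le_trans Nb; rewrite mulr_ge0// exprn_ge0.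
have [x1|x1] := leP (x ^+ 2) 1.
  apply: ler_pM => //; first by rewrite exprn_ge0//; lra.
    by rewrite lerXn2r ?nnegrE//; lra.
  by lra.
apply: (@le_trans _ _ ((2 * x ^+ 2) ^+ k * N)).
  by rewrite ler_wpM2r// lerXn2r ?nnegrE//; lra.
by rewrite exprMn -mulrA ler_wpM2l ?exprn_ge0//; lra.
Qed.

Lemma sqr_le_norm_le (u c w : R) (n : nat) : 0 <= c -> 0 < w ->
  w ^+ (n + n) * u ^+ 2 <= c ^+ 2 -> `|u| <= c / w ^+ n.
Proof.
move=> c0 w0 h; rewrite ler_pdivlMr ?exprn_gt0//.
rewrite -(ler_pXn2r (ltn0Sn 1)) ?nnegrE ?mulr_ge0 ?exprn_ge0 ?(ltW w0)//.
by rewrite exprMn real_normK ?num_real// mulrC -exprM mulnC mul2n -addnn.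
Qed.

(** [fsqr_decay] is taken at order [n + n] because it bounds squares and the square root halves the
    order. *)
Lemma fourier_decay (H M : R) (n : nat) f : 0 < M -> smooth f -> supp_in (- M) M f ->
  exists2 C : R, 0 <= C & forall tau x y : R, `|y| <= H ->
    `|fcos (fun t => f (t - tau)) x y| <= C * expR (2 * pi * H * `|tau|) / (1 + x ^+ 2) ^+ n
    /\ `|fsin (fun t => f (t - tau)) x y| <= C * expR (2 * pi * H * `|tau|) / (1 + x ^+ 2) ^+ n.
Proof.
move=> M0 sf sup.
have [C C0 HC] := fsqr_decay H 0 M0 sf sup.
have [D D0 HD] := fsqr_decay H (n + n) M0 sf sup.
exists (Num.sqrt (2 ^+ (n + n) * (C + D))); first exact: sqrtr_ge0.
move=> tau x y yH; set e := expR _; set F := fun t => f (t - tau).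
have e2 : expR (4 * pi * H * `|tau|) = e ^+ 2.
  exact: expR_4pi.
have F0 : 0 <= fsqr F x y by rewrite addr_ge0 ?sqr_ge0.
have h1 := HC tau x y yH; have h2 := HD tau x y yH.
rewrite expr0 mul1r e2 in h1; rewrite e2 in h2.
have h3 := weight_le F0 h1 h2; rewrite -mulrDl mulrA in h3.
have w0 : 0 < 1 + x ^+ 2 by have := sqr_ge0 x; lra.
have c0 : 0 <= Num.sqrt (2 ^+ (n + n) * (C + D)) * e.
  by rewrite mulr_ge0 ?sqrtr_ge0 ?expR_ge0.
have c2 : (Num.sqrt (2 ^+ (n + n) * (C + D)) * e) ^+ 2 = 2 ^+ (n + n) * (C + D) * e ^+ 2.
  by rewrite exprMn sqr_sqrtr// mulr_ge0 ?exprn_ge0// addr_ge0.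
split; apply: sqr_le_norm_le => //; rewrite c2; apply: le_trans h3;
  rewrite ler_wpM2l ?exprn_ge0 ?(ltW w0)// /fsqr.
  by rewrite lerDl sqr_ge0.
by rewrite lerDr sqr_ge0.
Qed.

Lemma fcos_dif_decay (M : R) (n : nat) f : 0 < M -> smooth f -> supp_in (- M) M f ->
  exists2 C : R, 0 <= C & forall x y : R, `|y| <= 1 ->
    `|fcos f x y - fcos f x 0| <= C * `|y| / (1 + x ^+ 2) ^+ n.
Proof.
move=> M0 sf sup.
have [C C0 HC] := fdif_decay 0 M0 sf sup.
have [D D0 HD] := fdif_decay (n + n) M0 sf sup.
exists (Num.sqrt (2 ^+ (n + n) * (C + D))); first exact: sqrtr_ge0.
move=> x y y1.
have F0 : 0 <= fdif f x y by rewrite addr_ge0 ?sqr_ge0.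
have h1 := HC x y y1; have h2 := HD x y y1.
rewrite expr0 mul1r in h1.
have h3 := weight_le F0 h1 h2; rewrite -mulrDl mulrA in h3.
have w0 : 0 < 1 + x ^+ 2 by have := sqr_ge0 x; lra.
apply: sqr_le_norm_le => //.
rewrite exprMn sqr_sqrtr; last by rewrite mulr_ge0 ?exprn_ge0// addr_ge0.
rewrite real_normK ?num_real//; apply: le_trans h3.
by rewrite ler_wpM2l ?exprn_ge0 ?(ltW w0)// /fdif lerDl sqr_ge0.
Qed.

End FourierLaplace.

(** * A test function with almost positive transform *)

Section PositiveKernel.
Variable R : realType.
Implicit Types f g F : R -> R.
Local Notation mu := (@lebesgue_measure R).

Lemma fcos_sum (I : Type) (r : seq I) (c : I -> R) (F : I -> R -> R) (a b x y : R) :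
  (forall i, smooth (F i)) -> (forall i, supp_in a b (F i)) ->
  fcos (fun t => \sum_(i <- r) c i * F i t) x y = \sum_(i <- r) c i * fcos (F i) x y.
Proof.
move=> sF supF; elim: r => [|i r IH].
  rewrite big_nil /fcos; under eq_Rintegral do rewrite big_nil mul0r.
  by rewrite Rintegral_cst// mul0r.
rewrite big_cons -IH /fcos -[X in _ + X]mul1r.
rewrite -Rintegral_linear; first last.
- apply: (@integrable_fcos _ a b); last first.
    move=> t tab; rewrite big1// => j _; by rewrite supF// mulr0.
  by apply: smooth_sum => j; apply: smoothM => //; exact: smooth_cst.
- exact: (@integrable_fcos _ a b).
by apply: eq_Rintegral => t _; rewrite big_cons; ring.
Qed.

Lemma fcos0E f (x : R) : fcos f x 0 = \int[mu]_t (f t * cos (2 * pi * x * t)).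
Proof.
apply: eq_Rintegral => t _.
by rewrite /coskern mulr0 mul0r expR0 mul1r.
Qed.

Lemma lipschitz_of_derive g (g' : R -> R) (Lam u v : R) :
  (forall t : R, is_derive t 1 g (g' t)) -> (forall t, `|g' t| <= Lam) ->
  `|g u - g v| <= Lam * `|u - v|.
Proof.
move=> dg gb.
have cg := continuous_is_derive dg.
wlog uv : u v / v <= u.
  move=> W; have [/W//|/ltW/W] := leP v u.
  by rewrite distrC [`|v - u|]distrC.
have [c _ ->] := MVT_segment uv (fun x _ => dg x) (continuous_subspaceT cg).
by rewrite normrM ler_wpM2r.
Qed.

Lemma riemann_step g (g' G : R -> R) (Lam v eta : R) : 0 <= eta ->
  (forall t : R, is_derive t 1 g (g' t)) -> (forall t, `|g' t| <= Lam) ->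
  (forall t : R, is_derive t 1 G (g t)) ->
  `|eta * g v - (G (v + eta) - G v)| <= Lam * eta ^+ 2.
Proof.
move=> eta0 dg gb dG; have cG := continuous_is_derive dG.
have vv : v <= v + eta by rewrite lerDl.
have [c cv ->] := MVT_segment vv (fun x _ => dG x) (continuous_subspaceT cG).
have -> : eta * g v - g c * (v + eta - v) = eta * (g v - g c) by ring.
rewrite normrM (ger0_norm eta0) expr2 mulrCA ler_wpM2l//.
have L0 : 0 <= Lam by apply: le_trans (gb 0).
apply: (le_trans (lipschitz_of_derive v c dg gb)).
rewrite ler_wpM2l//; move: cv; rewrite in_itv /= => cv.
by rewrite ler_norml; lra.
Qed.

(** The integral telescopes into increments of a primitive, each handled by [riemann_step]. The
    error is explicit in [Lam], since in [autocor_approx] that bound grows with the frequency. *)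
Lemma riemann_sum g (g' : R -> R) (a b Lam : R) (J : nat) : a < b -> (0 < J)%N ->
  continuous g -> supp_in a b g ->
  (forall t : R, is_derive t 1 g (g' t)) -> (forall t, `|g' t| <= Lam) ->
  `|(\sum_(0 <= j < J) (b - a) / J%:R * g (a + j%:R * ((b - a) / J%:R))) - \int[mu]_t g t|
    <= Lam * (b - a) * ((b - a) / J%:R).
Proof.
move=> ab J0 cg sg dg gb; have [G dG] := ex_antiderivative cg sg.
rewrite (Rintegral_FTC ab cg sg dG); set eta := (b - a) / J%:R.
have J0' : 0 < J%:R :> R by rewrite ltr0n.
have eta0 : 0 <= eta by rewrite divr_ge0 ?ler0n// subr_ge0 ltW.
have -> : G b - G a = \sum_(0 <= j < J) (G (a + j%:R * eta + eta) - G (a + j%:R * eta)).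
  have := @telescope_sumr _ 0%N J (fun j => G (a + j%:R * eta)) (leq0n _).
  rewrite mul0r addr0 /eta [J%:R * _]mulrC divfK ?gt_eqF// subrKC => <-.
  by apply: eq_big_nat => j _; rewrite -addrA -natr1 mulrDl mul1r.
rewrite -sumrB; apply: (le_trans (ler_norm_sum _ _ _)).
apply: (@le_trans _ _ (\sum_(0 <= j < J) Lam * eta ^+ 2)).
  by apply: ler_sum => j _; exact: riemann_step.
rewrite sumr_const_nat subn0 -mulr_natr.
have -> : b - a = eta * J%:R by rewrite /eta divfK// gt_eqF.
by rewrite le_eqVlt; apply/orP; left; apply/eqP; ring.
Qed.

(** A translate multiplies the transform by a phase; adding the opposite translate leaves a real
    factor, so [fsin] never enters. *)
Lemma fcos0_sym_shift (a b u x : R) f : a < b -> smooth f -> supp_in a b f ->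
  fcos (fun t => f (t - u)) x 0 + fcos (fun t => f (t + u)) x 0 =
  2 * cos (2 * pi * x * u) * fcos f x 0.
Proof.
move=> ab sf sup; have cf := smooth_continuous sf.
have cc v : continuous (fun s => cos (2 * pi * x * (s + v))).
  have H (s : R) : is_derive s 1 (fun s => cos (2 * pi * x * (s + v)))
       (2 * pi * x * (- sin (2 * pi * x * s + 2 * pi * x * v))).
    have := @is_derive_comp_affine _ cos (fun t => - sin t) (2 * pi * x)
      (2 * pi * x * v) s (@is_derive_cos R).
    by under eq_fun do rewrite -mulrDr.
  exact: continuous_is_derive H.
have E v : fcos (fun t => f (t - v)) x 0 = \int[mu]_t (f t * cos (2 * pi * x * (t + v))).
  rewrite fcos0E.
  have := @Rintegral_affine _ a b 1 (- v) _ ab (continuous_mulf cf (cc v))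
    (supp_inMr _ sup) ltr01.
  rewrite invr1 mul1r => <-; apply: eq_Rintegral => t _.
  by rewrite !mul1r subrK.
have -> : (fun t => f (t + u)) = (fun t => f (t - - u)).
  by apply/funext => t; rewrite opprK.
rewrite !E fcos0E -RintegralD//; last 2 first.
- exact: integrable_mul_supp sup (cc u).
- exact: integrable_mul_supp sup (cc (- u)).
rewrite -RintegralZl//; last first.
  have := integrable_mul_supp cf sup (cc 0); congr (_.-integrable _ _).
  by apply/funext => t /=; rewrite addr0.
apply: eq_Rintegral => t _; rewrite !mulrDr mulrN cosD cosB; ring.
Qed.

Section Kernel.
Variable psi : R -> R.
Hypotheses (spsi : smooth psi) (psi0 : forall t, 0 <= psi t)
  (psi1 : forall t, `|t| < 1 -> 1 <= psi t) (supp_psi : supp_in (- 2) 2 psi).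

(* A Riemann sum for the symmetrised autocorrelation of [psi]: a finite sum is smooth at
   once, and [fcos (autocor J) x 0] is close to [2 * fcos psi x 0 ^+ 2 >= 0]. *)
Definition autocor (J : nat) (t : R) : R :=
  \sum_(0 <= j < J) (4 / J%:R * psi (- 2 + j%:R * (4 / J%:R))) *
    (psi (t - (- 2 + j%:R * (4 / J%:R))) + psi (t + (- 2 + j%:R * (4 / J%:R)))).

Let node (J : nat) (j : nat) : R := - 2 + j%:R * (4 / J%:R).

Let node_le J (j : 'I_J) : `|node J j| <= 2.
Proof.
have J0 : 0 < J%:R :> R by rewrite ltr0n; exact: leq_ltn_trans (ltn_ord j).
have : 0 <= j%:R * (4 / J%:R) :> R by rewrite mulr_ge0// divr_ge0.
have : j%:R * (4 / J%:R) <= 4 :> R.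
  by rewrite mulrCA -[leRHS]mulr1 ler_pM2l// ler_pdivrMr// mul1r ler_nat ltnW.
by rewrite /node ler_norml; lra.
Qed.

Let supp_pair (u : R) : `|u| <= 2 -> supp_in (- 4) 4 (fun t => psi (t - u) + psi (t + u)).
Proof.
rewrite ler_norml => u2 t tab; rewrite !supp_psi ?addr0//.
  by case/orP: tab => tab; apply/orP; [left|right]; lra.
by case/orP: tab => tab; apply/orP; [left|right]; lra.
Qed.

Let smooth_pair (u : R) : smooth (fun t => psi (t - u) + psi (t + u)).
Proof.
apply: smoothD; first exact: smooth_shift.
have -> : (fun t => psi (t + u)) = (fun t => psi (t - - u)).
  by apply/funext => t; rewrite opprK.
exact: smooth_shift.
Qed.

Lemma smooth_autocor J : smooth (autocor J).
Proof.
by apply: smooth_sum => j; apply: smoothM; [exact: smooth_cst|exact: smooth_pair].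
Qed.

Lemma supp_in_autocor J : supp_in (- 4) 4 (autocor J).
Proof.
move=> t tab; rewrite /autocor big_mkord big1// => j _.
by have /= -> := @supp_pair (node J j) (node_le j) _ tab; rewrite mulr0.
Qed.

Lemma fcos_autocor J x : fcos (autocor J) x 0 = 2 * fcos psi x 0 *
  \sum_(0 <= j < J) 4 / J%:R * (psi (- 2 + j%:R * (4 / J%:R)) *
     cos (2 * pi * x * (- 2 + j%:R * (4 / J%:R)))).
Proof.
have -> : autocor J = (fun t => \sum_(j < J) (4 / J%:R * psi (node J j)) *
    (psi (t - node J j) + psi (t + node J j))).
  by apply/funext => t; rewrite /autocor big_mkord.
rewrite (@fcos_sum _ _ _ (fun (j : 'I_J) t => psi (t - node J j) + psi (t + node J j)) (- 4) 4);
  first last.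
- by move=> j; exact/supp_pair/node_le.
- by move=> j; exact: smooth_pair.
rewrite big_mkord mulr_sumr; apply: eq_bigr => j _.
suff -> : fcos (fun t => psi (t - node J j) + psi (t + node J j)) x 0 =
    2 * cos (2 * pi * x * node J j) * fcos psi x 0 by rewrite /node; ring.
have m22 : - 2 < 2 :> R by lra.
rewrite -(fcos0_sym_shift _ _ m22 spsi supp_psi) /fcos -RintegralD//; last 2 first.
- apply: integrable_fcos; first exact: smooth_shift.
  exact: (@supp_in_shift _ _ _ (node J j) _ supp_psi).
- have -> : (fun t => psi (t + node J j) * coskern x 0 t) =
     (fun t => psi (t - - node J j) * coskern x 0 t).
    by apply/funext => t; rewrite opprK.
  apply: integrable_fcos; first exact: smooth_shift.
  exact: (@supp_in_shift _ _ _ (- node J j) _ supp_psi).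
by apply: eq_Rintegral => t _; rewrite mulrDl.
Qed.

(** The transform of [autocor J] is [2 * A * T], where [T] is a Riemann sum for [A = fcos psi x 0].
    The error [T - A] is of order [(1 + x ^+ 2) / J]; the decay of [A] is taken at order [n.+1] to
    pay for this extra [1 + x ^+ 2]. *)
Lemma autocor_approx (n : nat) : exists2 C : R, 0 <= C & forall J x, (0 < J)%N ->
  2 * fcos psi x 0 ^+ 2 - C / J%:R / (1 + x ^+ 2) ^+ n <= fcos (autocor J) x 0.
Proof.
have [c0 c00 psic0] := supp_in_bounded (smooth_continuous spsi) supp_psi.
have [c1 c10 psic1] := supp_in_bounded (smooth_continuous (smooth_derive1 spsi))
  (supp_in_derive1 supp_psi).
have m20 : 0 < 2 :> R by [].
have [C C0 HC] := fourier_decay 0 n.+1 m20 spsi supp_psi.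
have pi0 := @pi_gt0 R.
pose c2 := c1 + 2 * pi * c0.
have c20 : 0 <= c2 by rewrite addr_ge0// !mulr_ge0// ltW.
exists (32 * C * c2); first by rewrite !mulr_ge0.
move=> J x J0; rewrite fcos_autocor; set A := fcos psi x 0; set T := \sum_(_ <= _ < _) _.
have x20 := sqr_ge0 x.
have w0 : 0 < 1 + x ^+ 2 by lra.
have Ale : `|A| <= C / (1 + x ^+ 2) ^+ n.+1.
  have [] := HC 0 x 0; first by rewrite normr0.
  rewrite normr0 mulr0 expR0 mulr1.
  by under [fun t => psi (t - 0)]eq_fun do rewrite subr0.
have J0' : 0 < J%:R :> R by rewrite ltr0n.
have TA : `|T - A| <= c2 * (1 + x ^+ 2) * 16 / J%:R.
  have dg (t : R) : is_derive t 1 (fun t => psi t * cos (2 * pi * x * t))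
     (psi t * - (2 * pi * x * sin (2 * pi * x * t)) + derive1 psi t * cos (2 * pi * x * t)).
    have d1 := smooth_is_derive spsi t; have := is_deriveM d1 (is_derive_cosM (2 * pi * x) t).
    by congr is_derive; rewrite /GRing.scale /=; ring.
  have gb t : `|psi t * - (2 * pi * x * sin (2 * pi * x * t)) +
      derive1 psi t * cos (2 * pi * x * t)| <= c2 * (1 + x ^+ 2).
    apply: (@le_trans _ _ (c0 * (2 * pi * `|x|) + c1)).
      apply: (le_trans (ler_normD _ _)); apply: lerD.
        rewrite normrM normrN ler_pM// !normrM normr_nat (gtr0_norm pi0).
        by rewrite ler_piMr ?mulr_ge0 ?(ltW pi0)// ler_norml sin_geN1 sin_le1.
      rewrite normrM -[leRHS]mulr1 ler_pM//.
      by rewrite ler_norml cos_geN1 cos_le1.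
    have xx : `|x| <= 1 + x ^+ 2.
      rewrite -[x ^+ 2]real_normK ?num_real//; have := normr_ge0 x.
      by move: `|x| => z z0; nra.
    rewrite /c2 (mulrDl c1) addrC; apply: lerD; first by rewrite ler_peMr//; lra.
    have -> : c0 * (2 * pi * `|x|) = 2 * pi * c0 * `|x| by ring.
    by rewrite ler_wpM2l// !mulr_ge0// ltW.
  have m22 : - 2 < 2 :> R by lra.
  have := riemann_sum m22 J0 (continuous_mulf (smooth_continuous spsi)
    (smooth_continuous (@smooth_cosM _ (2 * pi * x)))) (supp_inMr _ supp_psi) dg gb.
  rewrite -fcos0E -/A (_ : 2 - - 2 = 4); last ring.
  by rewrite -/T => h; apply: (le_trans h); rewrite le_eqVlt; apply/orP; left;
     apply/eqP; field; rewrite gt_eqF.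
have -> : 2 * A * T = 2 * A ^+ 2 + 2 * A * (T - A) by ring.
rewrite lerD2l lerNl; apply: (le_trans (ler_norm _)); rewrite normrN !normrM normr_nat.
apply: (@le_trans _ _ (2 * (C / (1 + x ^+ 2) ^+ n.+1) * (c2 * (1 + x ^+ 2) * 16 / J%:R))).
  by apply: ler_pM => //; rewrite ?mulr_ge0 ?ler_pM2l.
rewrite le_eqVlt; apply/orP; left; apply/eqP; rewrite exprS.
have : (1 + x ^+ 2) ^+ n != 0 by rewrite gt_eqF// exprn_gt0.
move: ((1 + x ^+ 2) ^+ n) => W W0; field.
by rewrite W0 ?(gt_eqF J0') ?(gt_eqF w0).
Qed.

Lemma fcos_psi_lower : exists2 L0 : R, 0 < L0 & forall x, `|x| <= L0 -> 1 / 2 <= fcos psi x 0.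
Proof.
have cpsi := smooth_continuous spsi.
have [c0 c00 psic0] := supp_in_bounded cpsi supp_psi.
have pi0 := @pi_gt0 R.
have m22 : - 2 < 2 :> R by lra.
have A0 : 1 <= fcos psi 0 0.
  have [G dG] := ex_antiderivative cpsi supp_psi.
  have -> : fcos psi 0 0 = G 2 - G (- 2).
    rewrite fcos0E -(Rintegral_FTC m22 cpsi supp_psi dG).
    by apply: eq_Rintegral => t _; rewrite mulr0 mul0r cos0 mulr1.
  have cG := continuous_is_derive dG.
  have incr u v : u <= v -> exists2 c, u <= c <= v & G v - G u = psi c * (v - u).
    move=> uv; have [c cuv ->] := MVT_segment uv (fun x _ => dG x) (continuous_subspaceT cG).
    by exists c => //; move: cuv; rewrite in_itv.
  have [c1 _ h1] : exists2 c, - 2 <= c <= - 2^-1 & G (- 2^-1) - G (- 2) = psi c * (- 2^-1 - - 2).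
    by apply: incr; lra.
  have [c2 _ h2] : exists2 c, 2^-1 <= c <= 2 & G 2 - G 2^-1 = psi c * (2 - 2^-1).
    by apply: incr; lra.
  (* This interval has length 1 and lies inside the open one where [psi >= 1], so it alone
     contributes at least 1. *)
  have [c3 hc3 h3] : exists2 c, - 2^-1 <= c <= 2^-1 & G 2^-1 - G (- 2^-1) = psi c * (2^-1 - - 2^-1).
    by apply: incr; lra.
  have p3 : 1 <= psi c3 by apply: psi1; rewrite ltr_norml; lra.
  have := psi0 c1; have := psi0 c2; lra.
have dif x : `|fcos psi x 0 - fcos psi 0 0| <= c0 * (4 * pi * `|x|) * 4.
  have ck z : continuous (coskern z 0 : R -> R) by exact/smooth_continuous/smooth_coskern.
  rewrite /fcos (Rintegral_mulB cpsi supp_psi (ck x) (ck 0)).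
  have -> : 4 = 2 - - 2 :> R by ring.
  apply: Rintegral_le_norm; [lra| |exact: supp_inMr|].
    by apply: continuous_mulf => // t; apply: cvgB; exact: ck.
  move=> t t2; rewrite normrM ler_pM// /coskern !mulr0 !mul0r expR0 !mul1r.
  have := lipschitz_of_derive (2 * pi * x * t) 0 (@is_derive_cos R)
    (_ : forall t, `|- sin t| <= 1).
  rewrite mul1r subr0 => h; apply: le_trans (h _) _.
    by move=> u; rewrite normrN ler_norml sin_geN1 sin_le1.
  rewrite !normrM normr_nat (gtr0_norm pi0).
  have t2' : `|t| <= 2 by rewrite ler_norml.
  have -> : (2 - - 2) * pi * `|x| = 2 * pi * `|x| * 2 by ring.
  by rewrite ler_wpM2l// !mulr_ge0// ltW.
(* [dif] is a Lipschitz bound with constant [16 * pi * c0], so the value, at least 1 at the origin,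
   loses at most [1 / 2]; the [+ 1] keeps the denominator positive. *)
exists (2^-1 / (16 * pi * c0 + 1)).
  by rewrite divr_gt0// ltr_wpDl// !mulr_ge0// ltW.
have d0 : 0 < 16 * pi * c0 + 1 by rewrite ltr_wpDl// !mulr_ge0// ltW.
move=> x; rewrite ler_pdivlMr// => hx; have := dif x; rewrite ler_norml => /andP[h _].
have : c0 * (4 * pi * `|x|) * 4 = `|x| * (16 * pi * c0 + 1) - `|x| by ring.
have := normr_ge0 x; lra.
Qed.

End Kernel.

(** [L0] precedes [n] and [kap]: it is determined by the bump, whereas the accuracy [kap] is reached
    by increasing [J]. The value [1 / 2] is [2 * (1 / 2) ^+ 2]. *)
Lemma positive_kernel : exists2 L0 : R, 0 < L0 & forall (n : nat) (kap : R), 0 < kap ->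
  exists phi : R -> R, [/\ smooth phi, supp_in (- 4) 4 phi,
    (forall x : R, - (kap / (1 + x ^+ 2) ^+ n) <= fcos phi x 0) &
    (forall x : R, `|x| <= L0 -> 1 / 2 - kap / (1 + x ^+ 2) ^+ n <= fcos phi x 0)].
Proof.
have [psi [spsi psi0 psi1 supp0]] := @smooth_bump R.
have supp_psi : supp_in (- 2) 2 psi.
  by move=> t tab; apply: supp0; rewrite lter_normr; case/orP: tab => ?; apply/orP;
     [right|left]; lra.
have [L0 L00 HL0] := fcos_psi_lower spsi psi0 psi1 supp_psi.
exists L0 => // n kap kap0.
have [C C0 HC] := autocor_approx spsi supp_psi n.
pose J := (Num.truncn (C / kap)).+1.
have J0 : 0 < J%:R :> R by rewrite ltr0n.
have CJ : C / J%:R <= kap.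
  rewrite ler_pdivrMr// mulrC -ler_pdivrMr//; apply/ltW.
  by rewrite /J; apply: Num.Theory.truncnS_gt.
have CW x : C / J%:R / (1 + x ^+ 2) ^+ n <= kap / (1 + x ^+ 2) ^+ n.
  rewrite ler_pM2r// invr_gt0 exprn_gt0//; have := sqr_ge0 x; lra.
exists (autocor psi J); split.
- exact: smooth_autocor.
- exact: supp_in_autocor.
- move=> x; apply: le_trans (HC J x isT).
  have := sqr_ge0 (fcos psi x 0); have := CW x; lra.
- move=> x /HL0 hx; apply: le_trans (HC J x isT).
  have := CW x; have : 1 / 4 <= fcos psi x 0 ^+ 2 by rewrite expr2; nra.
  lra.
Qed.

Lemma fcos_scale (M eps x y : R) f : 0 < M -> 0 < eps -> smooth f -> supp_in (- M) M f ->
  fcos (fun t => eps^-1 * f (eps^-1 * t + 0)) x y = fcos f (eps * x) (eps * y).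
Proof.
move=> M0 eps0 sf sup; have en0 : eps != 0 by rewrite gt_eqF.
have MM : - M < M by lra.
have ck : continuous (coskern (eps * x) (eps * y) : R -> R).
  exact/smooth_continuous/smooth_coskern.
have ei : 0 < eps^-1 by rewrite invr_gt0.
have cf := smooth_continuous sf.
have := Rintegral_affine 0 MM (continuous_mulf cf ck) (supp_inMr _ sup) ei.
rewrite invrK -/(fcos _ _ _) => h.
have -> : fcos f (eps * x) (eps * y) = eps^-1 * (eps * fcos f (eps * x) (eps * y)).
  by rewrite mulKf.
rewrite -h -RintegralZl//; last first.
  apply: (@integrable_mul_supp _ (- (M * eps)) (M * eps)).
  - exact/smooth_continuous/smooth_comp_affine.
  - move=> t tab; rewrite sup// addr0 mulrC ltr_pdivrMr// ltr_pdivlMr//.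
    by rewrite mulNr.
  - exact/smooth_continuous/smooth_comp_affine/smooth_coskern.
apply: eq_Rintegral => t _; rewrite -mulrA; congr (_ * (_ * _)).
by rewrite /coskern; congr (expR _ * cos _); rewrite addr0; field.
Qed.

(* Shrinking the support by [eps] turns the strip of half-width [H] into one of
   half-width [eps * H], on which the transform barely differs from its real values. *)
Lemma strip_kernel : exists2 L0 : R, 0 < L0 & forall (n : nat) (kap H : R), 0 < kap -> 0 < H ->
  exists (phi : R -> R) (eps M : R), [/\ smooth phi, 0 < M, supp_in (- M) M phi, 0 < eps &
    forall x y : R, `|y| <= H -> - (kap / (1 + (eps * x) ^+ 2) ^+ n) <= fcos phi x y /\
      (`|eps * x| <= L0 -> 1 / 2 - kap / (1 + (eps * x) ^+ 2) ^+ n <= fcos phi x y)].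
Proof.
have [L0 L00 HL0] := positive_kernel; exists L0 => // n kap H kap0 H0.
have k20 : 0 < kap / 2 by rewrite divr_gt0.
have [phi [sphi supp h1 h2]] := HL0 n _ k20.
have m40 : 0 < 4 :> R by [].
have [C C0 HC] := fcos_dif_decay n m40 sphi supp.
(* The first bound puts the scaled strip inside [|y| <= 1], where [fcos_dif_decay] applies; the
   second makes the change across the strip cost at most [kap / 2], the other half being spent on
   the real line. *)
pose eps := Num.min H^-1 (kap / (2 * (C + 1) * H)).
have eps0 : 0 < eps.
  by rewrite lt_min invr_gt0 H0 divr_gt0// !mulr_gt0//; lra.
have eH : eps * H <= 1 by rewrite -ler_pdivlMr// div1r ge_min lexx.
have CeH : C * (eps * H) <= kap / 2.
  have : eps <= kap / (2 * (C + 1) * H) by rewrite ge_min lexx orbT.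
  rewrite ler_pdivlMr ?mulr_gt0//; last lra.
  rewrite (_ : eps * (2 * (C + 1) * H) = 2 * (C * (eps * H)) + 2 * (eps * H)); last ring.
  have := mulr_gt0 eps0 H0; lra.
exists (fun t => eps^-1 * phi (eps^-1 * t + 0)), eps, (4 * eps); split => //.
- by apply: smoothM; [exact: smooth_cst|exact: smooth_comp_affine].
- by rewrite mulr_gt0.
- move=> t tab; rewrite supp ?mulr0// addr0 mulrC ltr_pdivrMr// ltr_pdivlMr//.
  by rewrite mulNr.
move=> x y yH; rewrite (fcos_scale _ _ m40)//.
have ey : `|eps * y| <= eps * H by rewrite normrM (gtr0_norm eps0) ler_pM2l.
have := HC (eps * x) (eps * y) (le_trans ey eH).
set W := (1 + _) ^+ n.
have W0 : 0 < W by rewrite exprn_gt0//; have := sqr_ge0 (eps * x); lra.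
have : C * `|eps * y| / W <= kap / 2 / W.
  rewrite ler_pM2r ?invr_gt0//; apply: le_trans CeH.
  by rewrite ler_wpM2l.
have -> : kap / W = kap / 2 / W + kap / 2 / W by field; rewrite gt_eqF.
rewrite ler_norml => hW /andP[hd _]; split.
  by have := h1 (eps * x); rewrite -/W; lra.
by move=> hx; have := h2 _ hx; rewrite -/W; lra.
Qed.

End PositiveKernel.

(** * Integrals over the strip *)

Section Strip.
Variable R : realType.
Implicit Types (m : {measure set (R * R)%type -> \bar R}) (z : (R * R)%type).

Definition strip_box (H l s : R) : set (R * R)%type :=
  [set z | (s <= z.1 <= s + l)%R /\ (`|z.2| <= H)%R].

Definition wgt (n : nat) (c s : R) z : R := ((1 + (c * (z.1 - s)) ^+ 2) ^+ n)^-1.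

Lemma measurable_preim (f : (R * R)%type -> R) (Y : set R) :
  measurable_fun setT f -> measurable Y -> measurable (f @^-1` Y).
Proof. by move=> mf mY; rewrite -[X in measurable X]setTI; exact: mf. Qed.

Lemma measurable_norm_snd : measurable_fun setT (fun z => `|z.2| : R).
Proof. exact: (measurableT_comp (@normr_measurable R setT) measurable_snd). Qed.

Lemma measurable_dist_fst (s : R) : measurable_fun setT (fun z => `|z.1 - s| : R).
Proof.
apply: (measurableT_comp (@normr_measurable R setT)).
by apply: measurable_funB => //; exact: measurable_fst.
Qed.

Lemma measurable_strip_out (H : R) : measurable [set z : (R * R)%type | H < `|z.2|].
Proof.
have -> : [set z : (R * R)%type | H < `|z.2|] = (fun z => `|z.2|) @^-1` `]H, +oo[%classic.
  by apply/seteqP; split => z /=; rewrite in_itv /= andbT.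
by apply: measurable_preim => //; exact: measurable_norm_snd.
Qed.

Lemma measurable_strip_box (H l s : R) : measurable (strip_box H l s).
Proof.
have -> : strip_box H l s = (fst @^-1` `[s, s + l]%classic) `&`
   ((fun z => `|z.2|) @^-1` `]-oo, H]%classic).
  by apply/seteqP; split => z /=; rewrite !in_itv /=.
by apply: measurableI; apply: measurable_preim => //; exact: measurable_norm_snd.
Qed.

Lemma wgt_gt0 n c s z : 0 < wgt n c s z.
Proof.
by rewrite invr_gt0 exprn_gt0//; have := sqr_ge0 (c * (z.1 - s)); lra.
Qed.

Lemma measurable_wgt n c s : measurable_fun setT (wgt n c s).
Proof.
have ct : continuous (fun x : R => ((1 + (c * (x - s)) ^+ 2) ^+ n)^-1).
  have -> : (fun x : R => ((1 + (c * (x - s)) ^+ 2) ^+ n)^-1) =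
      (fun x => ((1 + (c * x + - (c * s)) ^+ 2) ^+ n)^-1).
    by apply/funext => x; rewrite mulrBr.
  move=> x; apply: cvgV.
    by rewrite gt_eqF// exprn_gt0//; have := sqr_ge0 (c * x - c * s); lra.
  have sm : smooth (fun x : R => (1 + (c * x + - (c * s)) ^+ 2) ^+ n).
    apply: smoothX; apply: smoothD; first exact: smooth_cst.
    by apply: smoothX; exact: smooth_affine.
  exact: (@smooth_continuous _ _ sm x).
exact: (measurableT_comp (continuous_measurable_fun ct) measurable_fst).
Qed.

(** Half-open in the distance to [s], so that the rings partition the strip. *)
Definition ring_box (H l s : R) (k : nat) : set (R * R)%type :=
  [set z | (k%:R * l <= `|z.1 - s| < k.+1%:R * l)%R /\ (`|z.2| <= H)%R].

Lemma measurable_ring_box H l s k : measurable (ring_box H l s k).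
Proof.
have -> : ring_box H l s k = ((fun z => `|z.1 - s|) @^-1` `[k%:R * l, k.+1%:R * l[%classic) `&`
   ((fun z => `|z.2|) @^-1` `]-oo, H]%classic).
  by apply/seteqP; split => z /=; rewrite !in_itv /=.
apply: measurableI; apply: measurable_preim => //; first exact: measurable_dist_fst.
exact: measurable_norm_snd.
Qed.

Lemma trivIset_ring_box H l s : 0 < l -> trivIset setT (ring_box H l s).
Proof.
move=> l0; apply/trivIsetP => i j _ _ ij; apply/seteqP; split => // z [[/andP[i1 i2] _] [/andP[j1 j2] _]].
have : (i < j.+1)%N by rewrite -(ltr_nat R) -(ltr_pM2r l0); exact: le_lt_trans j2.
have : (j < i.+1)%N by rewrite -(ltr_nat R) -(ltr_pM2r l0); exact: le_lt_trans i2.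
by rewrite !ltnS => ji ij'; move: ij; rewrite eqn_leq ij' ji.
Qed.

Lemma bigcup_ring_box H l s : 0 < l ->
  \bigcup_k ring_box H l s k = setT `\` [set z : (R * R)%type | H < `|z.2|].
Proof.
move=> l0; apply/seteqP; split => z.
  by move=> [k _ [_ zH]]; split => //=; apply/negP; rewrite -leNgt.
move=> [_ /= /negP]; rewrite -leNgt => zH.
exists (Num.truncn (`|z.1 - s| / l)) => //; split => //.
have := @truncn_itv R (`|z.1 - s| / l); rewrite divr_ge0 ?(ltW l0)// => /(_ isT).
by rewrite ler_pdivlMr// ltr_pdivrMr.
Qed.

(** The ring is covered by one box on each side of [s]. Their left ends [v] satisfy
    [1 + |v| / l <= (k + 2) (1 + |s| / l)], which gives the factor [(k + 2) ^+ q]. *)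
Lemma ring_box_le (q : nat) m (H l D a : R) (s : R) (k : nat) : 0 < l -> 0 <= D -> 0 <= a ->
  (forall s, (m (strip_box H l s) <= (D + a * (1 + `|s| / l) ^+ q)%:E)%E) ->
  (m (ring_box H l s k) <= (2 * (k%:R + 2) ^+ q * (D + a * (1 + `|s| / l) ^+ q))%:E)%E.
Proof.
move=> l0 D0 a0 hm.
have k0 : 0 <= k%:R :> R by [].
have step v : `|v| <= `|s| + (k%:R + 1) * l ->
   (m (strip_box H l v) <= ((k%:R + 2) ^+ q * (D + a * (1 + `|s| / l) ^+ q))%:E)%E.
  move=> vs; apply: (le_trans (hm v)); rewrite lee_fin mulrDr lerD//.
    by rewrite ler_peMl// exprn_ege1//; lra.
  rewrite mulrCA ler_wpM2l// -exprMn lerXn2r// ?nnegrE ?addr_ge0 ?divr_ge0 ?(ltW l0)//.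
    by rewrite mulr_ge0// ?addr_ge0 ?divr_ge0 ?(ltW l0)//.
  have : `|v| / l <= `|s| / l + (k%:R + 1).
    by rewrite ler_pdivrMr// mulrDl divfK ?gt_eqF.
  have : 0 <= `|s| / l by rewrite divr_ge0// ltW.
  by move: (`|s| / l) (`|v| / l) => x y; nra.
apply: (@le_trans _ _ (m (strip_box H l (s + k%:R * l) `|` strip_box H l (s - (k%:R + 1) * l)))).
  apply: le_measure; rewrite ?inE.
  - exact: measurable_ring_box.
  - by apply: measurableU; exact: measurable_strip_box.
  move=> z [/andP[h1 h2] zH]; rewrite -natr1 in h2.
  have [zs|zs] := leP 0 (z.1 - s).
    left; split => //; rewrite (ger0_norm zs) in h1 h2; lra.
  right; split => //; rewrite (ltr0_norm zs) in h1 h2; lra.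
apply: (le_trans (measureU2 _ _ _)); try exact: measurable_strip_box.
rewrite -mulrA [2 * _](_ : _ = (k%:R + 2) ^+ q * (D + a * (1 + `|s| / l) ^+ q) +
  (k%:R + 2) ^+ q * (D + a * (1 + `|s| / l) ^+ q)); last by rewrite mulrDl mul1r.
rewrite EFinD; apply: leeD; apply: step.
  apply: (le_trans (ler_normD _ _)); rewrite lerD2l normrM (gtr0_norm l0) ger0_norm//.
  by rewrite ler_pM2r//; lra.
apply: (le_trans (ler_normB _ _)); rewrite lerD2l normrM (gtr0_norm l0) ger0_norm//; lra.
Qed.

(** The constant 8 comes from [(k + 2)^2 <= 8 (1 + k^2)]; powers of [k + 2] are wanted because they
    cancel against the mass bound of [ring_box_le]. *)
Lemma wgt_ring_le (q : nat) (L0 H l s : R) (k : nat) z : 0 < L0 -> 0 < l ->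
  ring_box H l s k z ->
  wgt q.+1 (L0 / l) s z <= ((Num.min 1 (L0 ^+ 2) / 8 * (k%:R + 2) ^+ 2) ^+ q.+1)^-1.
Proof.
move=> L00 l0 [/andP[h1 _] _]; set lam := Num.min _ _.
have lam0 : 0 < lam by rewrite lt_min ltr01 exprn_gt0.
have k0 : 0 <= k%:R :> R by [].
have p1 : 0 < 1 + (L0 / l * (z.1 - s)) ^+ 2.
  by have := sqr_ge0 (L0 / l * (z.1 - s)); lra.
have p2 : 0 < lam / 8 * (k%:R + 2) ^+ 2.
  by rewrite mulr_gt0 ?divr_gt0 ?exprn_gt0//; lra.
rewrite /wgt lef_pV2 ?posrE ?exprn_gt0// lerXn2r ?nnegrE ?(ltW p1) ?(ltW p2)//.
have h2 : k%:R ^+ 2 <= ((z.1 - s) / l) ^+ 2.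
  rewrite -[leRHS]real_normK ?num_real// lerXn2r ?nnegrE// normrM normfV (gtr0_norm l0).
  by rewrite ler_pdivlMr.
have -> : (L0 / l * (z.1 - s)) ^+ 2 = L0 ^+ 2 * ((z.1 - s) / l) ^+ 2 by ring.
apply: (@le_trans _ _ (1 + L0 ^+ 2 * k%:R ^+ 2)); last first.
  by rewrite lerD2l ler_wpM2l// sqr_ge0.
have l1 : lam <= 1 by rewrite ge_min lexx.
have l2 : lam <= L0 ^+ 2 by rewrite ge_min lexx orbT.
have l3 : lam * k%:R ^+ 2 <= L0 ^+ 2 * k%:R ^+ 2 by rewrite ler_wpM2r ?sqr_ge0.
apply: (@le_trans _ _ (lam + lam * k%:R ^+ 2)); last by rewrite lerD.
rewrite -mulrA -[X in _ <= X + _]mulr1 -mulrDr ler_wpM2l ?(ltW lam0)//; nra.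
Qed.

(** On the ring [k] the weight is of order [(k + 2) ^- (2 q + 2)] and the mass of order
    [(k + 2) ^+ q]. Their product is at most a multiple of [1 / ((k + 1) (k + 2))], whose sum
    telescopes. [K] is uniform in the measure, in [l], [D] and [a]. *)
Lemma weight_integral (q : nat) (L0 : R) : 0 < L0 -> exists2 K : R, 0 < K &
  forall m (H l D a : R), 0 < l -> 0 <= D -> 0 <= a -> m [set z : (R * R)%type | H < `|z.2|] = 0%E ->
  (forall s, (m (strip_box H l s) <= (D + a * (1 + `|s| / l) ^+ q)%:E)%E) ->
  forall s, (\int[m]_z (wgt q.+1 (L0 / l) s z)%:E <= (K * (D + a * (1 + `|s| / l) ^+ q))%:E)%E.
Proof.
move=> L00; pose lam := Num.min 1 (L0 ^+ 2) / 8.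
have lam0 : 0 < lam by rewrite divr_gt0// lt_min ltr01 exprn_gt0.
pose K := 2 / lam ^+ q.+1; exists K; first by rewrite divr_gt0// exprn_gt0.
move=> m H l D a l0 D0 a0 m0 hm s; set E := D + _.
have E0 : 0 <= E by rewrite addr_ge0// mulr_ge0// exprn_ge0// addr_ge0// divr_ge0// ltW.
have mw : measurable_fun setT (fun z => (wgt q.+1 (L0 / l) s z)%:E).
  by apply/measurable_EFinP; exact: measurable_wgt.
rewrite (@ge0_negligible_integral _ _ _ _ _ [set z : (R * R)%type | H < `|z.2|])//; first last.
- by move=> z _; rewrite lee_fin ltW// wgt_gt0.
- exact: measurable_strip_out.
rewrite -(bigcup_ring_box H s l0) ge0_integral_bigcup//; first last.
- exact: trivIset_ring_box.
- by move=> z _; rewrite lee_fin ltW// wgt_gt0.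
- exact: measurable_funS mw.
- by move=> k; exact: measurable_ring_box.
apply: (@le_trans _ _ (\sum_(0 <= k <oo) (K * E * (k.+1%:R^-1 - k.+2%:R^-1))%:E)%E).
  apply: lee_nneseries => [k _ _|k _].
    by apply: integral_ge0 => z _; rewrite lee_fin ltW// wgt_gt0.
  pose v := ((lam * (k%:R + 2) ^+ 2) ^+ q.+1)^-1.
  have k20 : 0 < k%:R + 2 :> R by rewrite ltr_wpDl.
  have v0 : 0 <= v by rewrite invr_ge0 exprn_ge0// mulr_ge0 ?exprn_ge0 ?(ltW lam0) ?(ltW k20).
  apply: (@le_trans _ _ (\int[m]_(z in ring_box H l s k) (cst v%:E) z)%E).
    apply: ge0_le_integral => //.
    - exact: measurable_ring_box.
    - by move=> z _; rewrite lee_fin ltW// wgt_gt0.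
    - exact: measurable_funS mw.
    - by move=> z hz; rewrite lee_fin; exact: wgt_ring_le hz.
  rewrite integral_cst; last exact: measurable_ring_box.
  apply: (@le_trans _ _ (v%:E * (2 * (k%:R + 2) ^+ q * E)%:E)%E).
    by rewrite lee_wpmul2l ?lee_fin//; exact: ring_box_le.
  rewrite -EFinM lee_fin.
  have -> : v * (2 * (k%:R + 2) ^+ q * E) = K * E * ((k%:R + 2) ^+ q / ((k%:R + 2) ^+ 2) ^+ q.+1).
    by rewrite /v /K exprMn invfM; ring.
  rewrite ler_wpM2l ?mulr_ge0 ?invr_ge0 ?exprn_ge0 ?(ltW lam0)//.
  have -> : k.+1%:R^-1 - k.+2%:R^-1 = ((k%:R + 1) * (k%:R + 2))^-1 :> R.
    rewrite -natr1 -[k.+2%:R]natr1 -natr1; field.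
    by rewrite !gt_eqF// ltr_wpDl.
  apply: (@le_trans _ _ (((k%:R + 2) ^+ 2)^-1)); last first.
    by rewrite lef_pV2 ?posrE ?mulr_gt0 ?exprn_gt0 ?ltr_wpDl// expr2 ler_pM2r//; lra.
  have -> : ((k%:R + 2) ^+ 2) ^+ q.+1 = (k%:R + 2) ^+ q * ((k%:R + 2) ^+ q * (k%:R + 2) ^+ 2) :> R.
    by rewrite -exprM -!exprD; congr (_ ^+ _); rewrite mulnS mul2n -addnn addnC addnA.
  rewrite invfM mulVKf ?gt_eqF ?exprn_gt0// lef_pV2 ?posrE ?mulr_gt0 ?exprn_gt0//.
  by rewrite ler_peMl ?exprn_ge0 ?(ltW k20)// exprn_ege1//; have := ler0n R k; lra.
apply: lime_le.
  apply: is_cvg_nneseries => k _ _; rewrite lee_fin mulr_ge0//.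
    by rewrite mulr_ge0// divr_ge0// exprn_ge0// ltW.
  by rewrite subr_ge0 lef_pV2 ?posrE ?ltr0n// ler_nat.
apply: nearW => N; rewrite sumEFin lee_fin -mulr_sumr.
have -> : \sum_(0 <= k < N) (k.+1%:R^-1 - k.+2%:R^-1) = 1 - N.+1%:R^-1 :> R.
  elim: N => [|N IH]; first by rewrite big_nil invr1 subrr.
  by rewrite big_nat_recr//= IH; ring.
by rewrite ler_piMr ?gerBl ?invr_ge0// mulr_ge0// divr_ge0// exprn_ge0// ltW.
Qed.

Local Notation mu := (@lebesgue_measure R).

(** Tonelli's theorem concerns nonnegative functions, so it is applied to the positive and negative
    parts, whose integrals are then subtracted. *)
Lemma measurable_param_Rintegral (g : ((R * R) * measurableTypeR R)%type -> R) : measurable_fun setT g ->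
  measurable_fun setT (fun z : (R * R)%type => \int[mu]_t g (z, t)).
Proof.
move=> mg; have mg' : measurable_fun setT (EFin \o g) by apply/measurable_EFinP.
have mp := @measurable_fun_fubini_tonelli_F _ _ (R * R)%type (measurableTypeR R) R mu
  ((EFin \o g)^\+)%E (measurable_funepos mg') (fun x => funepos_ge0 _ x).
have mn := @measurable_fun_fubini_tonelli_F _ _ (R * R)%type (measurableTypeR R) R mu
  ((EFin \o g)^\-)%E (measurable_funeneg mg') (fun x => funeneg_ge0 _ x).
have mi : measurable_fun setT (fun z : (R * R)%type => (\int[mu]_t (g (z, t))%:E)%E).
  rewrite [X in measurable_fun _ X](_ : _ = (fubini_F mu ((EFin \o g)^\+)%E \-
    fubini_F mu ((EFin \o g)^\-)%E)%E); first exact: emeasurable_funB.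
  apply/funext => z; rewrite [LHS]integralE /fubini_F /=.
  congr (_ - _)%E; apply: eq_integral => t _.
    by rewrite !funeposE.
  by rewrite !funenegE.
exact: (measurableT_comp (fine_measurable measurableT) mi).
Qed.

Lemma measurable_fun_mulkern (f k : R -> R) (s : R) : continuous f -> continuous k ->
  measurable_fun setT (fun p : ((R * R) * measurableTypeR R)%type =>
    f p.2 * (expR (2 * pi * p.1.2 * p.2) * k (2 * pi * (p.1.1 - s) * p.2))).
Proof.
move=> cf ck.
have m11 : measurable_fun setT (fun p : ((R * R) * measurableTypeR R)%type => p.1.1).
  exact: (measurableT_comp measurable_fst measurable_fst).
have m12 : measurable_fun setT (fun p : ((R * R) * measurableTypeR R)%type => p.1.2).
  exact: (measurableT_comp measurable_snd measurable_fst).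
have m2 : measurable_fun setT (fun p : ((R * R) * measurableTypeR R)%type => p.2).
  exact: measurable_snd.
apply: measurable_funM.
  exact: (measurableT_comp (continuous_measurable_fun cf) m2).
apply: measurable_funM.
  apply: (measurableT_comp (@measurable_expR R)).
  by apply: measurable_funM => //; exact: measurable_funM.
apply: (measurableT_comp (continuous_measurable_fun ck)).
apply: measurable_funM => //; apply: measurable_funM => //.
exact: measurable_funB.
Qed.

Lemma measurable_fcos (f : R -> R) s : continuous f ->
  measurable_fun setT (fun z : (R * R)%type => fcos f (z.1 - s) z.2).
Proof.
move=> cf; exact: (measurable_param_Rintegral (measurable_fun_mulkern s cf (@continuous_cos R))).
Qed.

Lemma measurable_fsin (f : R -> R) s : continuous f ->
  measurable_fun setT (fun z : (R * R)%type => fsin f (z.1 - s) z.2).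
Proof.
move=> cf; exact: (measurable_param_Rintegral (measurable_fun_mulkern s cf (@continuous_sin R))).
Qed.

Lemma strip_integral_le m (H : R) (n : nat) (c s C B : R) (g : (R * R)%type -> R) :
  m [set z | H < `|z.2|] = 0%E -> measurable_fun setT g -> 0 <= C ->
  (forall z, `|z.2| <= H -> `|g z| <= C * wgt n c s z) ->
  (\int[m]_z (wgt n c s z)%:E <= B%:E)%E ->
  m.-integrable setT (EFin \o g) /\ `|\int[m]_z g z| <= C * B.
Proof.
move=> m0 mg C0 gC wB.
have mN := measurable_strip_out H.
have mw : measurable_fun setT (fun z => (wgt n c s z)%:E).
  by apply/measurable_EFinP; exact: measurable_wgt.
have mng : measurable_fun setT (fun z => `|(g z)%:E|%E).
  by apply: measurableT_comp => //; exact/measurable_EFinP.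
have w0 z : (0 <= (wgt n c s z)%:E)%E by rewrite lee_fin ltW// wgt_gt0.
have le : (\int[m]_z `|(g z)%:E| <= (C * B)%:E)%E.
  rewrite (ge0_negligible_integral mN measurableT)//.
  apply: (@le_trans _ _ (\int[m]_(z in setT `\` [set z | (H < `|z.2|)%R]) (C%:E * (wgt n c s z)%:E))%E).
    apply: ge0_le_integral => //.
    - exact: measurableD.
    - exact: measurable_funS mng.
    - by apply: measurable_funeM; exact: measurable_funS mw.
    - by move=> z [_ /negP]; rewrite -leNgt => zH; rewrite -EFinM lee_fin; exact: gC.
  rewrite ge0_integralZl_EFin//; first last.
  - exact: measurable_funS mw.
  - exact: measurableD.
  rewrite EFinM lee_wpmul2l ?lee_fin//; apply: le_trans wB.
  apply: ge0_subset_integral => //; exact: measurableD.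
have int : m.-integrable setT (EFin \o g).
  apply/integrableP; split; first exact/measurable_EFinP.
  by apply: le_lt_trans le _; exact: ltry.
split => //; rewrite -lee_fin; apply: le_trans le.
rewrite EFin_normr_Rintegral//; apply: le_abse_integral => //.
exact/measurable_EFinP.
Qed.

End Strip.

(** * Mean square of trigonometric polynomials *)

Section TrigMean.
Variable R : realType.

Lemma is_derive_sum_seq (I : Type) (r : seq I) (h h' : I -> R -> R) (u : R) :
  (forall i (v : R), is_derive v 1 (h i) (h' i v)) ->
  is_derive u 1 (fun v => \sum_(i <- r) h i v) (\sum_(i <- r) h' i u).
Proof.
move=> dh; elim: r => [|i r IH].
  under eq_fun do rewrite big_nil; rewrite big_nil; exact: is_derive_cst.
under eq_fun do rewrite big_cons; rewrite big_cons.
by have := dh i u => ?; exact: is_deriveD.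
Qed.

(* Over [0, U] this antiderivative of [cross_term] grows like [U] on the diagonal and stays
   bounded off it. *)
Definition cross_prim (a b : R -> R) (g d u : R) : R :=
  if g == d then (a g ^+ 2 + b g ^+ 2) * u
  else ((a g * a d + b g * b d) * sin (2 * pi * (g - d) * u) -
        (a g * b d - b g * a d) * cos (2 * pi * (g - d) * u)) / (2 * pi * (g - d)).

Definition cross_term (a b : R -> R) (g d u : R) : R :=
  (a g * a d + b g * b d) * cos (2 * pi * (g - d) * u) +
  (a g * b d - b g * a d) * sin (2 * pi * (g - d) * u).

Lemma is_derive_cross (a b : R -> R) (g d u : R) :
  is_derive u 1 (cross_prim a b g d) (cross_term a b g d u).
Proof.
rewrite /cross_prim; case: eqVneq => [->|gd].
  have := is_derive_affine (a d ^+ 2 + b d ^+ 2) 0 u.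
  under eq_fun do rewrite addr0.
  by rewrite /cross_term subrr mulr0 mul0r cos0 sin0; congr is_derive; ring.
have w0 : 2 * pi * (g - d) != 0.
  by rewrite mulf_neq0 ?subr_eq0// mulf_neq0 ?pnatr_eq0// gt_eqF// pi_gt0.
have H1 := is_derive_cosM (2 * pi * (g - d)) u.
have H2 := is_derive_sinM (2 * pi * (g - d)) u.
apply: is_derive_eq; rewrite /GRing.scale /= /cross_term.
by move: (2 * pi * (g - d)) w0 {H1 H2} => w w0; field.
Qed.

(** For [g = d] the denominator is 0 and, since [x / 0 = 0], so is the bound: one formula serves on
    and off the diagonal. *)
Definition cross_bound (a b : R -> R) (g d : R) : R :=
  2 * ((`|a g * a d + b g * b d| + `|a g * b d - b g * a d|) / `|2 * pi * (g - d)|).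

Lemma cross_prim_ge (a b : R -> R) (g d U : R) :
  (if g == d then (a g ^+ 2 + b g ^+ 2) * U else 0) - cross_bound a b g d <=
  cross_prim a b g d U - cross_prim a b g d 0.
Proof.
rewrite /cross_prim; case: eqVneq => [->|gd].
  by rewrite mulr0 lerD2l lerN2 /cross_bound subrr mulr0 normr0 invr0 !mulr0.
pose B := (`|a g * a d + b g * b d| + `|a g * b d - b g * a d|) / `|2 * pi * (g - d)|.
set X := a g * a d + _ in B *; set Y := a g * b d - _ in B *.
have bd u : `|(X * sin (2 * pi * (g - d) * u) - Y * cos (2 * pi * (g - d) * u)) /
    (2 * pi * (g - d))| <= B.
  rewrite normrM normfV ler_wpM2r ?invr_ge0//; apply: (le_trans (ler_normB _ _)).
  rewrite lerD// normrM ler_piMr// ler_norml.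
    by rewrite sin_geN1 sin_le1.
  by rewrite cos_geN1 cos_le1.
have := bd U; have := bd 0; rewrite /cross_bound -/X -/Y -/B !ler_norml.
by move=> /andP[? ?] /andP[? ?]; lra.
Qed.

Definition trig_re (a b : R -> R) (r : seq R) (u : R) :=
  \sum_(g <- r) (a g * cos (2 * pi * u * g) - b g * sin (2 * pi * u * g)).
Definition trig_im (a b : R -> R) (r : seq R) (u : R) :=
  \sum_(g <- r) (a g * sin (2 * pi * u * g) + b g * cos (2 * pi * u * g)).

Lemma trig_sqrE (a b : R -> R) (r : seq R) (u : R) :
  trig_re a b r u ^+ 2 + trig_im a b r u ^+ 2 =
  \sum_(g <- r) \sum_(d <- r) cross_term a b g d u.
Proof.
rewrite /trig_re /trig_im !expr2 !mulr_suml -big_split /=; apply: eq_bigr => g _.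
rewrite !mulr_sumr -big_split /=; apply: eq_bigr => d _.
rewrite /cross_term.
have -> : 2 * pi * (g - d) * u = 2 * pi * u * g - 2 * pi * u * d by ring.
by rewrite cosB sinB; ring.
Qed.

(** No limit of averages is taken. The function [E] has derivative [K - |f u|^2 >= 0], so
    [E 0 <= E U]; the diagonal of the double sum then gives [S * U <= K * U + B] for all [U >= 0],
    which forces [S <= K]. *)
Lemma trig_mean_le (a b : R -> R) (r : seq R) (K : R) : uniq r ->
  (forall u, trig_re a b r u ^+ 2 + trig_im a b r u ^+ 2 <= K) ->
  \sum_(g <- r) (a g ^+ 2 + b g ^+ 2) <= K.
Proof.
move=> ur HK; set S := \sum_(g <- r) _.
pose E u := K * u - \sum_(g <- r) \sum_(d <- r) cross_prim a b g d u.
have dE (u : R) : is_derive u 1 E (K - \sum_(g <- r) \sum_(d <- r) cross_term a b g d u).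
  have H1 := is_derive_affine K 0 u.
  have H2 : is_derive u 1 (fun u => \sum_(g <- r) \sum_(d <- r) cross_prim a b g d u)
     (\sum_(g <- r) \sum_(d <- r) cross_term a b g d u).
    apply: (@is_derive_sum_seq _ _ (fun g u => \sum_(d <- r) cross_prim a b g d u)
      (fun g u => \sum_(d <- r) cross_term a b g d u)) => g v.
    by apply: is_derive_sum_seq => d w; exact: is_derive_cross.
  have -> : E = fun u => (K * u + 0) - \sum_(g <- r) \sum_(d <- r) cross_prim a b g d u.
    by apply/funext => v; rewrite addr0.
  exact: is_deriveB.
have cE := continuous_is_derive dE.
pose B := \sum_(g <- r) \sum_(d <- r) cross_bound a b g d.
have key U : 0 <= U -> S * U <= K * U + B.
  move=> U0; have [c _] := MVT_segment U0 (fun x _ => dE x) (continuous_subspaceT cE).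
  rewrite -trig_sqrE subr0 => EU.
  have : 0 <= E U - E 0 by rewrite EU mulr_ge0// subr_ge0.
  have : S * U - B <= \sum_(g <- r) \sum_(d <- r) cross_prim a b g d U -
      \sum_(g <- r) \sum_(d <- r) cross_prim a b g d 0.
    rewrite -sumrB; under [leRHS]eq_bigr do rewrite -sumrB.
    have -> : S * U - B = \sum_(g <- r) \sum_(d <- r)
       ((if g == d then (a g ^+ 2 + b g ^+ 2) * U else 0) - cross_bound a b g d).
      under [RHS]eq_bigr do rewrite sumrB.
      rewrite sumrB -/B; congr (_ - _); rewrite /S mulr_suml.
      rewrite !big_seq; apply: eq_bigr => g gr.
      rewrite -big_mkcond /=; under eq_bigl do rewrite eq_sym.
      by rewrite -[RHS]big_filter filter_pred1_uniq// big_seq1.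
    by apply: ler_sum => g _; apply: ler_sum => d _; exact: cross_prim_ge.
  rewrite /E mulr0; lra.
rewrite leNgt; apply/negP => KS.
have SK : 0 < S - K by rewrite subr_gt0.
have B0 : 0 <= `|B| + 1 by rewrite addr_ge0.
(* At this [U] the inequality [(S - K) * U <= B] would read [|B| + 1 <= B]. *)
have := key ((`|B| + 1) / (S - K)) (divr_ge0 B0 (ltW SK)).
rewrite -lerBlDl -mulrBl mulrC divfK ?gt_eqF//.
have := ler_norm B; lra.
Qed.

End TrigMean.

(** * Unordered sums *)

Section Sums.
Variable R : realType.
Implicit Types (D : set R) (f d : R -> R) (r : seq R).

Lemma funrpos_le_norm f i : f^\+ i <= `|f i|.
Proof. by rewrite /funrpos ge_max ler_norm normr_ge0. Qed.

Lemma funrneg_le_norm f i : f^\- i <= `|f i|.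
Proof. by rewrite /funrneg ge_max -normrN ler_norm normr_ge0. Qed.

(** Finiteness is carried along with the bound because [fine] sends [+oo] to 0. *)
Lemma fine_esum_le D f g (B : R) : (forall i, 0 <= f i) -> (forall i, f i <= g i) ->
  (\esum_(i in D) (g i)%:E <= B%:E)%E ->
  (\esum_(i in D) (f i)%:E \is a fin_num) /\ 0 <= fine (\esum_(i in D) (f i)%:E) <= B.
Proof.
move=> f0 fg gB.
have h0 : (0 <= \esum_(i in D) (f i)%:E)%E by apply: esum_ge0 => i _; rewrite lee_fin.
have h1 : (\esum_(i in D) (f i)%:E <= B%:E)%E.
  by apply: le_trans gB; apply: le_esum => i _; rewrite lee_fin.
have fin : \esum_(i in D) (f i)%:E \is a fin_num.
  by rewrite ge0_fin_numE//; apply: le_lt_trans h1 _; exact: ltry.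
by split => //; rewrite -!lee_fin fineK// h0 h1.
Qed.

Lemma rsum_norm_le D f (B : R) :
  (\esum_(i in D) (`|f i|)%:E <= B%:E)%E -> `|rsum D f| <= B.
Proof.
move=> fB.
have [_ h1] := fine_esum_le (funrpos_ge0 f) (funrpos_le_norm f) fB.
have [_ h2] := fine_esum_le (funrneg_ge0 f) (funrneg_le_norm f) fB.
by rewrite /rsum ler_norml; lra.
Qed.

Lemma esum_seq r f : uniq r -> (forall i, 0 <= f i) ->
  (\esum_(i in [set` r]) (f i)%:E = (\sum_(i <- r) f i)%:E)%E.
Proof.
move=> ur f0; rewrite esum_fset//; [|exact: finite_seq|by move=> i _; rewrite lee_fin].
by rewrite -fsbig_seq// sumEFin.
Qed.

Lemma rsum_split D f r (tau : R) : uniq r -> [set` r] `<=` D ->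
  (\esum_(i in D `&` ~` [set` r]) (`|f i|)%:E <= tau%:E)%E ->
  `|rsum D f - \sum_(i <- r) f i| <= tau.
Proof.
move=> ur rD ftau.
have [fin1 h1] := fine_esum_le (funrpos_ge0 f) (funrpos_le_norm f) ftau.
have [fin2 h2] := fine_esum_le (funrneg_ge0 f) (funrneg_le_norm f) ftau.
have E (g : R -> R) : (forall i, 0 <= g i) ->
   \esum_(i in D `&` ~` [set` r]) (g i)%:E \is a fin_num ->
   fine (\esum_(i in D) (g i)%:E) =
   \sum_(i <- r) g i + fine (\esum_(i in D `&` ~` [set` r]) (g i)%:E).
  move=> g0 fin; rewrite (esumID [set` r]); last by move=> i _; rewrite lee_fin.
  by rewrite (setIidr rD) esum_seq// fineD.
rewrite /rsum (E _ (funrpos_ge0 f) fin1) (E _ (funrneg_ge0 f) fin2).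
have -> : \sum_(i <- r) f i = \sum_(i <- r) f^\+ i - \sum_(i <- r) f^\- i.
  rewrite -sumrB; apply: eq_bigr => i _.
  by rewrite -{1}(funrposBneg f).
by rewrite ler_norml; lra.
Qed.

(** The finite part is made to contain a prescribed [r0], so that a bound for the squares over [r]
    passes to [r0]. *)
Lemma esum_tail D d r0 (tau : R) : (forall i, 0 <= d i) ->
  (\esum_(i in D) (d i)%:E < +oo)%E -> 0 < tau -> [set` r0] `<=` D ->
  exists r, [/\ uniq r, {subset r0 <= r}, [set` r] `<=` D &
    (\esum_(i in D `&` ~` [set` r]) (d i)%:E <= tau%:E)%E].
Proof.
move=> d0 dfin tau0 r0D.
have e0 (A : set R) : (0 <= \esum_(i in A) (d i)%:E)%E.
  by apply: esum_ge0 => i _; rewrite lee_fin.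
have fin : \esum_(i in D) (d i)%:E \is a fin_num by rewrite ge0_fin_numE.
have [x [A [finA AD] <-] hx] := ub_ereal_sup_adherent tau0 fin.
pose r := undup (finmap.enum_fset (fset_set A) ++ r0).
have Ar : A `<=` [set` r].
  move=> i Ai; rewrite /= mem_undup mem_cat; apply/orP; left.
  by rewrite in_fset_set// inE.
have rD : [set` r] `<=` D.
  move=> i /=; rewrite mem_undup mem_cat => /orP[|/r0D//].
  by rewrite in_fset_set// inE => /AD.
exists r; split => //; first exact: undup_uniq.
  by move=> i ir; rewrite mem_undup mem_cat ir orbT.
move: hx; rewrite -/(esum D _) (esumID [set` r]); last by move=> i _; rewrite lee_fin.
rewrite (setIidr rD); set P := \esum_(i in [set` r]) _; set T := \esum_(i in _) _.
have xP : (\sum_(i \in A) (d i)%:E <= P)%E by apply: ereal_sup_ubound; exists A.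
have Pfin : P \is a fin_num by rewrite /P esum_seq ?undup_uniq.
rewrite lteBlDr// => h; apply/ltW.
have : (P + T < P + tau%:E)%E by apply: lt_le_trans h _; rewrite leeD2r.
by rewrite lteD2lE.
Qed.

(** Absolute summability lets the series be cut to a trigonometric polynomial with an error [tau]
    uniform in [u]; [trig_mean_le] applies to it, and [tau] tends to 0. The factor 2 arises because
    the real and imaginary parts are bounded by [K] separately. *)
Lemma bessel_bound D (al be : R -> R) (K : R) : 0 <= K ->
  (\esum_(g in D) (`|al g| + `|be g|)%:E < +oo)%E ->
  (forall u, `|rsum D (fun g => al g * cos (2 * pi * u * g) - be g * sin (2 * pi * u * g))| <= K) ->
  (forall u, `|rsum D (fun g => al g * sin (2 * pi * u * g) + be g * cos (2 * pi * u * g))| <= K) ->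
  forall r, uniq r -> [set` r] `<=` D ->
    \sum_(g <- r) (al g ^+ 2 + be g ^+ 2) <= 2 * K ^+ 2.
Proof.
move=> K0 dfin Hre Him r0 ur0 r0D.
have d0 g : 0 <= `|al g| + `|be g| by rewrite addr_ge0.
have main tau : 0 < tau -> \sum_(g <- r0) (al g ^+ 2 + be g ^+ 2) <= 2 * (K + tau) ^+ 2.
  move=> tau0; have [r [ur r0r rD tail]] := esum_tail d0 dfin tau0 r0D.
  apply: (@le_trans _ _ (\sum_(g <- r) (al g ^+ 2 + be g ^+ 2))).
    rewrite -lee_fin -!esum_seq//; try by move=> i; rewrite addr_ge0 ?sqr_ge0.
    apply: ereal_sup_le => _ [A [finA Ar0] <-]; exists A => //; split => //.
    by move=> i /Ar0; exact: r0r.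
  apply: trig_mean_le => // u.
  have bd (k1 k2 : R -> R) : (forall t, `|k1 t| <= 1) -> (forall t, `|k2 t| <= 1) ->
     `|rsum D (fun g => al g * k1 (2 * pi * u * g) + be g * k2 (2 * pi * u * g))| <= K ->
     (\sum_(g <- r) (al g * k1 (2 * pi * u * g) + be g * k2 (2 * pi * u * g))) ^+ 2
        <= (K + tau) ^+ 2.
    move=> h1 h2 hK; set F := fun g => _ in hK; rewrite -/(F _).
    have hs : `|rsum D F - \sum_(g <- r) F g| <= tau.
      apply: rsum_split => //; apply: le_trans tail; apply: le_esum => g _.
      rewrite lee_fin; apply: (le_trans (ler_normD _ _)).
      by rewrite !normrM lerD// ler_piMr.
    rewrite -[X in X <= _]real_normK ?num_real// lerXn2r ?nnegrE ?addr_ge0 ?(ltW tau0)//.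
    by move: hs hK; rewrite !ler_norml; lra.
  rewrite mulrDl mul1r lerD//.
    have := bd cos (fun t => - sin t) _ _ _.
    rewrite /trig_re; under eq_bigr do rewrite mulrN; apply.
    - by move=> t; rewrite ler_norml cos_geN1 cos_le1.
    - by move=> t; rewrite normrN ler_norml sin_geN1 sin_le1.
    - by have := Hre u; under [fun g => _ - _]eq_fun do rewrite -mulrN.
  apply: (bd sin cos) => //.
  - by move=> t; rewrite ler_norml sin_geN1 sin_le1.
  - by move=> t; rewrite ler_norml cos_geN1 cos_le1.
apply/ler_addgt0Pr => e e0.
(* For [tau <= 1], [2 (K + tau)^2 - 2 K^2 = tau (4 K + 2 tau)] is at most [tau (4 K + 2)]. *)
pose tau := Num.min 1 (e / (4 * K + 2)).
have t0 : 0 < tau by rewrite lt_min ltr01 divr_gt0//; lra.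
have t1 : tau <= 1 by rewrite ge_min lexx.
have te : tau * (4 * K + 2) <= e by rewrite -ler_pdivlMr ?ge_min ?lexx ?orbT//; lra.
apply: (le_trans (main _ t0)); nra.
Qed.

Lemma esum_le_seq D d (C : R) : (forall r, uniq r -> [set` r] `<=` D ->
  \sum_(g <- r) d g <= C) -> (\esum_(g in D) (d g)%:E <= C%:E)%E.
Proof.
move=> h; apply: ge_ereal_sup => _ [A [finA AD] <-].
rewrite fsbig_finite// sumEFin lee_fin; apply: h; first exact: finmap.fset_uniq.
by move=> i /=; rewrite in_fset_set// inE => /AD.
Qed.

End Sums.

(** * The measure and its transform *)

Section Assembly.
Variable R : realType.
Local Notation mu := (@lebesgue_measure R).

Lemma normc_ge_Re (w : R[i]) : `|complex.Re w| <= Normc.normc w.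
Proof.
case: w => a b /=; rewrite -sqrtr_sqr ler_sqrt ?addr_ge0 ?sqr_ge0//.
by rewrite lerDl sqr_ge0.
Qed.

Lemma normc_ge_Im (w : R[i]) : `|complex.Im w| <= Normc.normc w.
Proof.
case: w => a b /=; rewrite -sqrtr_sqr ler_sqrt ?addr_ge0 ?sqr_ge0//.
by rewrite lerDr sqr_ge0.
Qed.

Lemma normc_sqr (w : R[i]) : Normc.normc w ^+ 2 = complex.Re w ^+ 2 + complex.Im w ^+ 2.
Proof. by case: w => a b /=; rewrite sqr_sqrtr ?addr_ge0 ?sqr_ge0. Qed.

Lemma normc_ge0 (w : R[i]) : 0 <= Normc.normc w.
Proof. by case: w => a b /=; exact: sqrtr_ge0. Qed.

Definition modulate (f : R -> R) (u t : R) : R[i] :=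
  Complex (f t * cos (2 * pi * u * t)) (f t * sin (2 * pi * u * t)).

Lemma test_fun_modulate (f : R -> R) (a b u : R) : smooth f -> supp_in a b f ->
  test_fun (modulate f u).
Proof.
move=> sf sup; split.
- by apply: smoothM => //; exact: smooth_cosM.
- by apply: smoothM => //; exact: smooth_sinM.
exists (`|a| + `|b|) => t tab; rewrite /modulate sup ?mul0r//.
have [h|h] := ltP t a => //=; rewrite ltNge; apply/negP => tb.
have : `|t| <= `|a| + `|b|.
  rewrite ler_norml; have := ler_norm b; have := ler_norm (- a); rewrite normrN.
  by have := normr_ge0 a; have := normr_ge0 b; lra.
by rewrite leNgt tab.
Qed.

Lemma fourier_c_modulate (f : R -> R) (a b u x y : R) : smooth f -> supp_in a b f ->
  fourier_c (modulate f u) x y = Complex (fcos f (x - u) y) (- fsin f (x - u) y).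
Proof.
move=> sf sup; rewrite /fourier_c /cint /modulate /cexpc /=; congr Complex.
- apply: eq_Rintegral => t _; rewrite /coskern.
  have -> : 2 * pi * (x - u) * t = 2 * pi * x * t - 2 * pi * u * t by ring.
  by rewrite cosB; ring.
- rewrite -mulN1r /fsin -RintegralZl//; last exact: integrable_fsin sup _ _.
  apply: eq_Rintegral => t _; rewrite /sinkern.
  have -> : 2 * pi * (x - u) * t = 2 * pi * x * t - 2 * pi * u * t by ring.
  by rewrite sinB; ring.
Qed.

Lemma Rintegral_strip_ge0 (m : {measure set (R * R)%type -> \bar R}) (H : R)
    (g : (R * R)%type -> R) : m [set z | H < `|z.2|] = 0%E ->
  m.-integrable setT (EFin \o g) -> (forall z, `|z.2| <= H -> 0 <= g z) ->
  0 <= \int[m]_z g z.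
Proof.
move=> mN ig g0; rewrite /Rintegral (negligible_integral (measurable_strip_out H))//.
apply: fine_ge0; apply: integral_ge0 => z [_ /= /negP]; rewrite -leNgt => zH.
by rewrite lee_fin; exact: g0.
Qed.

Section Transform.
Variables (H : R) (m : {measure set (R * R)%type -> \bar R}) (h : (R * R)%type -> R[i])
  (Gamma : set R) (b : R -> R[i]).
Hypotheses (H0 : 0 < H) (mN : m [set z | H < `|z.2|] = 0%E)
  (mh1 : measurable_fun setT (fun z => complex.Re (h z)))
  (mh2 : measurable_fun setT (fun z => complex.Im (h z)))
  (bfin : forall K : R,
    (\esum_(g in Gamma `&` [set g | (`|g| <= K)%R]) (Normc.normc (b g))%:E < +oo)%E)
  (Hid : forall phi : R -> R[i], test_fun phi ->
     cint m (fun z => fourier_c phi z.1 z.2 * h z) = csum Gamma (fun g => b g * phi g)).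

Let al (f : R -> R) g := complex.Re (b g) * f g.
Let be (f : R -> R) g := complex.Im (b g) * f g.

Lemma transform_Re f (a c u : R) : smooth f -> supp_in a c f ->
  \int[m]_z (fcos f (z.1 - u) z.2 * complex.Re (h z) + fsin f (z.1 - u) z.2 * complex.Im (h z)) =
  rsum Gamma (fun g => al f g * cos (2 * pi * u * g) - be f g * sin (2 * pi * u * g)).
Proof.
move=> sf sup; have := Hid (@test_fun_modulate f a c u sf sup).
rewrite /cint /csum => /(congr1 (@complex.Re R)) /= E.
rewrite (_ : (fun g => _ - _) = (fun g => complex.Re (b g * modulate f u g))); last first.
  by apply/funext => g; rewrite /al /be /modulate; case: (b g) => p q /=; ring.
rewrite -E; apply: eq_Rintegral => z _.
by rewrite (fourier_c_modulate _ _ _ sf sup); case: (h z) => p q /=; ring.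
Qed.

Lemma transform_Im f (a c u : R) : smooth f -> supp_in a c f ->
  \int[m]_z (fcos f (z.1 - u) z.2 * complex.Im (h z) - fsin f (z.1 - u) z.2 * complex.Re (h z)) =
  rsum Gamma (fun g => al f g * sin (2 * pi * u * g) + be f g * cos (2 * pi * u * g)).
Proof.
move=> sf sup; have := Hid (@test_fun_modulate f a c u sf sup).
rewrite /cint /csum => /(congr1 (@complex.Im R)) /= E.
rewrite (_ : (fun g => _ + _) = (fun g => complex.Im (b g * modulate f u g))); last first.
  by apply/funext => g; rewrite /al /be /modulate; case: (b g) => p q /=; ring.
rewrite -E; apply: eq_Rintegral => z _.
by rewrite (fourier_c_modulate _ _ _ sf sup); case: (h z) => p q /=; ring.
Qed.

Lemma summable_coef f (a c : R) : continuous f -> supp_in a c f ->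
  exists2 B : R, 0 <= B & (\esum_(g in Gamma) (`|al f g| + `|be f g|)%:E <= B%:E)%E.
Proof.
move=> cf sup; have [c0 c00 fc] := supp_in_bounded cf sup.
pose M := `|a| + `|c|.
set S := \esum_(g in Gamma `&` [set g | (`|g| <= M)%R]) (Normc.normc (b g))%:E.
have S0 : (0 <= S)%E by apply: esum_ge0 => g _; rewrite lee_fin normc_ge0.
have Sfin : S \is a fin_num by rewrite ge0_fin_numE// bfin.
exists (2 * c0 * fine S); first by rewrite !mulr_ge0// fine_ge0.
apply: esum_le_seq => r ur rG.
apply: (@le_trans _ _ (\sum_(g <- r) if `|g| <= M then 2 * c0 * Normc.normc (b g) else 0)).
  apply: ler_sum => g _; rewrite /al /be; case: ifPn => gM.
    rewrite !normrM -mulrDl [leRHS]mulrAC ler_pM// ?addr_ge0//.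
    by rewrite mulrDl mul1r lerD// ?normc_ge_Re ?normc_ge_Im.
  rewrite sup ?mulr0 ?normr0 ?addr0//.
  have [ga|ga] := ltP g a => //=; rewrite ltNge; apply/negP => gc.
  move: gM; rewrite /M ler_norml => /negP; apply.
  have := ler_norm c; have := ler_norm (- a); rewrite normrN.
  by have := normr_ge0 a; have := normr_ge0 c; lra.
rewrite -big_mkcond -mulr_sumr ler_wpM2l ?mulr_ge0// -big_filter.
rewrite -lee_fin fineK// -(@esum_seq _ _ (fun g => Normc.normc (b g))) ?filter_uniq//; last first.
  by move=> g; exact: normc_ge0.
apply: ereal_sup_le => _ [A [finA Ar] <-]; exists A => //; split => //.
move=> g /Ar /=; rewrite mem_filter => /andP[gM gr]; split => //; exact: rG.
Qed.

(** The a priori bound from which the halving starts. The box lies in the centred one of half-width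
    [|s| + l], and [1 + |s| + l <= (1 + l) (1 + |s| / l)]. *)
Lemma growth_strip_box (C0 rho l s : R) (q : nat) : 0 < C0 -> 0 < rho -> rho <= q%:R -> 0 < l ->
  (forall r : R, 0 < r ->
     (m [set z | (`|z.1| <= r)%R /\ (`|z.2| <= H)%R] <= (C0 * Num.max 1 (r `^ rho))%:E)%E) ->
  (m (strip_box H l s) <= (C0 * (1 + l) ^+ q * (1 + `|s| / l) ^+ q)%:E)%E.
Proof.
move=> C00 rho0 rhoq l0 growth.
have r0 : 0 < `|s| + l by rewrite ltr_wpDl.
have sl0 : 0 <= `|s| / l by rewrite divr_ge0// ltW.
apply: (@le_trans _ _ (m [set z | (`|z.1| <= `|s| + l)%R /\ (`|z.2| <= H)%R])).
  have -> : [set z : (R * R)%type | (`|z.1| <= `|s| + l)%R /\ (`|z.2| <= H)%R] =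
      strip_box H (2 * (`|s| + l)) (- (`|s| + l)).
    by apply/seteqP; split => z /= [h2 h3]; split => //; move: h2; rewrite ler_norml; lra.
  apply: le_measure; rewrite ?inE; try exact: measurable_strip_box.
  move=> z [h2 h3]; split => //.
  by have := ler_norm s; have := ler_norm (- s); rewrite normrN; lra.
apply: (le_trans (growth _ r0)); rewrite lee_fin -mulrA ler_pM2l// -exprMn.
have -> : (1 + l) * (1 + `|s| / l) = 1 + (`|s| + l) + `|s| / l by field; rewrite gt_eqF.
apply: (@le_trans _ _ ((1 + (`|s| + l)) ^+ q)); last by rewrite lerXn2r ?nnegrE//; lra.
rewrite ge_max exprn_ege1 /=; last lra.
rewrite -powR_mulrn; last lra.
apply: (@le_trans _ _ ((1 + (`|s| + l)) `^ rho)).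
  by apply: ge0_ler_powR; rewrite ?nnegrE; lra.
by apply: ler_powR => //; lra.
Qed.

(* The growing part of the bound halves at each step while [D] is preserved. *)
Lemma bounded_of_halving (l D a0 : R) (q : nat) : 0 < l -> 0 <= a0 ->
  (forall a : R, 0 <= a ->
    (forall s : R, (m (strip_box H l s) <= (D + a * (1 + `|s| / l) ^+ q)%:E)%E) ->
    forall s : R, (m (strip_box H l s) <= (D + a / 2 * (1 + `|s| / l) ^+ q)%:E)%E) ->
  (forall s : R, (m (strip_box H l s) <= (D + a0 * (1 + `|s| / l) ^+ q)%:E)%E) ->
  forall s : R, (m (strip_box H l s) <= D%:E)%E.
Proof.
move=> l0 a00 step init.
have iter_step (j : nat) (s : R) :
    (m (strip_box H l s) <= (D + a0 / 2 ^+ j * (1 + `|s| / l) ^+ q)%:E)%E.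
  elim: j s => [|j IH] s; first by rewrite expr0 divr1; exact: init.
  have aj : 0 <= a0 / 2 ^+ j by rewrite divr_ge0// exprn_ge0.
  by rewrite exprSr invfM mulrA; exact: step.
move=> s; apply/lee_addgt0Pr => e e0.
set A := a0 * (1 + `|s| / l) ^+ q.
pose j := (Num.truncn (A / e)).+1.
apply: (le_trans (iter_step j s)); rewrite -EFinD lee_fin lerD2l mulrAC -/A.
rewrite ler_pdivrMr ?exprn_gt0// mulrC -ler_pdivrMr//.
apply/ltW; apply: (@lt_trans _ _ j%:R); first exact: Num.Theory.truncnS_gt.
by rewrite -natrX ltr_nat ltn_expl.
Qed.

(** On the strip, the translated [fcos phi] plus [kap] times the weight is nonnegative, and at least
    [1 / 2] on the box. Integrating this against [m], which is positive, and replacing the integral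
    of [fcos phi] by the tested value gives the bound. *)
Lemma strip_box_le_kernel (phi : R -> R) (M eps L0 kap E E' s : R) (n : nat) :
  (forall z, h z = 1) -> smooth phi -> 0 < M -> supp_in (- M) M phi ->
  0 < eps -> 0 < L0 -> 0 <= kap ->
  (forall x y : R, `|y| <= H -> - (kap / (1 + (eps * x) ^+ 2) ^+ n) <= fcos phi x y /\
     (`|eps * x| <= L0 -> 1 / 2 - kap / (1 + (eps * x) ^+ 2) ^+ n <= fcos phi x y)) ->
  (\int[m]_z (wgt n eps s z)%:E <= E%:E)%E ->
  (\int[m]_z (wgt n 1 s z)%:E <= E'%:E)%E ->
  (m (strip_box H (L0 / eps) s) < +oo)%E ->
  fine (m (strip_box H (L0 / eps) s)) <=
    2 * (rsum Gamma (fun g => al phi g * cos (2 * pi * s * g) - be phi g * sin (2 * pi * s * g))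
         + kap * E).
Proof.
move=> h1 sphi M0 supp eps0 L00 kap0 ker wB wB' Xlty.
have w_ge0 n' (c s' : R) z : 0 <= @wgt R n' c s' z by exact/ltW/wgt_gt0.
have [C C_ge0 HC] := fourier_decay H n M0 sphi supp.
(* The decay of [fcos phi] is known at scale 1, not [eps]; the second weight, with its bound [E'],
   serves for this integrability. *)
have [intF _] : m.-integrable setT (EFin \o (fun z => fcos phi (z.1 - s) z.2)) /\
    `|\int[m]_z fcos phi (z.1 - s) z.2| <= C * E'.
  apply: (strip_integral_le mN _ C_ge0 _ wB').
    by apply: measurable_fcos; exact: smooth_continuous.
  move=> z zH; have [+ _] := HC 0 (z.1 - s) z.2 zH.
  rewrite normr0 mulr0 expR0 mulr1 /wgt mul1r.
  by under [fun t => phi (t - 0)]eq_fun do rewrite subr0.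
have [intW leW] : m.-integrable setT (EFin \o wgt n eps s) /\
    `|\int[m]_z wgt n eps s z| <= 1 * E.
  apply: (strip_integral_le mN _ ler01 _ wB); first exact: measurable_wgt.
  by move=> z _; rewrite mul1r ger0_norm.
set X := strip_box H (L0 / eps) s.
have mX : measurable X by exact: measurable_strip_box.
have Xker z : X z -> `|eps * (z.1 - s)| <= L0.
  move=> [zs _]; rewrite normrM (gtr0_norm eps0) mulrC -ler_pdivlMr// ler_norml.
  have : 0 < L0 / eps by rewrite divr_gt0.
  lra.
have L2 : 0 <= (1 + L0 ^+ 2) ^+ n by rewrite exprn_ge0// addr_ge0// sqr_ge0.
have [intX _] : m.-integrable setT (EFin \o (\1_X : (R * R)%type -> R)) /\
    `|\int[m]_z (\1_X z : R)| <= (1 + L0 ^+ 2) ^+ n * E.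
  apply: (strip_integral_le mN _ L2 _ wB); first exact: measurable_indic.
  move=> z _; rewrite indicE; case: (boolP (z \in X)) => zX; last first.
    by rewrite normr0 mulr_ge0.
  have p0 : 0 < 1 + (eps * (z.1 - s)) ^+ 2.
    by have := sqr_ge0 (eps * (z.1 - s)); lra.
  rewrite normr1 /wgt ler_pdivlMr ?exprn_gt0// mul1r.
  rewrite lerXn2r ?nnegrE ?(ltW p0) ?addr_ge0 ?sqr_ge0// lerD2l.
  rewrite -[leLHS]real_normK ?num_real// lerXn2r ?nnegrE ?(ltW L00)//.
  by apply: Xker; move: zX; rewrite inE.
have intG := integrable_linear 1 kap intF intW.
have intT := integrable_linear 1 (- 2^-1) intG intX.
have pos : 0 <= \int[m]_z (1 * (1 * fcos phi (z.1 - s) z.2 + kap * wgt n eps s z)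
    + - 2^-1 * \1_X z).
  apply: (Rintegral_strip_ge0 mN intT) => z zH.
  have [k1 k2] := ker (z.1 - s) z.2 zH.
  rewrite indicE; case: (boolP (z \in X)) => zX; rewrite /wgt /=; last lra.
  by rewrite inE in zX; have := k2 (Xker z zX); lra.
rewrite (Rintegral_linear _ _ intG intX) (Rintegral_linear _ _ intF intW) in pos.
have EF : \int[m]_z fcos phi (z.1 - s) z.2 =
    rsum Gamma (fun g => al phi g * cos (2 * pi * s * g) - be phi g * sin (2 * pi * s * g)).
  rewrite -(transform_Re _ sphi supp).
  by apply: eq_Rintegral => z _; rewrite h1 /= mulr1 mulr0 addr0.
have intXE : \int[m]_z (\1_X z : R) = fine (m X).
  by rewrite /Rintegral integral_indic// setIT.
rewrite -EF -intXE.
have := ler_wpM2l kap0 (le_trans (ler_norm _) leW); rewrite mul1r; lra.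
Qed.

Lemma translation_bounded_of_positive :
  (forall z, h z = 1) ->
  (exists C0 rho : R, 0 < C0 /\ 0 < rho /\ forall r : R, 0 < r ->
     (m [set z | (`|z.1| <= r)%R /\ (`|z.2| <= H)%R] <= (C0 * Num.max 1 (r `^ rho))%:E)%E) ->
  exists l D : R, [/\ 0 < l, 0 <= D & forall s, (m (strip_box H l s) <= D%:E)%E].
Proof.
move=> h1 [C0 [rho [C00 [rho0 growth]]]].
pose q := (Num.truncn rho).+1.
have rhoq : rho <= q%:R by apply/ltW; exact: Num.Theory.truncnS_gt.
have [L0 L00 kernel] := @strip_kernel R.
have [K K0 HK] := weight_integral q L00.
(* The kernel bound contributes [2 * kap * K * E], which this choice makes [E / 2]. *)
have kap0 : 0 < (4 * K)^-1 by rewrite invr_gt0 mulr_gt0.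
have [phi [eps [M [sphi M0 supp eps0 ker]]]] := kernel q.+1 _ H kap0 H0.
have [B B0 HB] := summable_coef (smooth_continuous sphi) supp.
pose l := L0 / eps.
have l0 : 0 < l by rewrite divr_gt0.
have L0l : L0 / l = eps by rewrite /l invf_div mulrC divfK// gt_eqF.
have a00 : 0 <= C0 * (1 + l) ^+ q by rewrite mulr_ge0 ?exprn_ge0 ?addr_ge0// ltW.
have B40 : 0 <= 4 * B by rewrite mulr_ge0.
(* [4 * B] is the fixed point of [D |-> 2 * B + D / 2], so a step halves [a] and leaves [D]
   unchanged. *)
exists l, (4 * B); split => //; apply: (@bounded_of_halving l _ _ q l0 a00); last first.
  move=> s; apply: (le_trans (growth_strip_box s C00 rho0 rhoq l0 growth)).
  by rewrite lee_fin lerDr.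
move=> a a_ge0 hm s; set E := 4 * B + a * (1 + `|s| / l) ^+ q.
have wB := HK m H l _ _ l0 B40 a_ge0 mN hm s; rewrite L0l -/E in wB.
have [K' _ HK'] := weight_integral q l0.
have wB' := HK' m H l _ _ l0 B40 a_ge0 mN hm s; rewrite divff ?gt_eqF// -/E in wB'.
have Xlty : (m (strip_box H (L0 / eps) s) < +oo)%E.
  by apply: le_lt_trans (hm s) _; exact: ltry.
have := strip_box_le_kernel h1 sphi M0 supp eps0 L00 (ltW kap0) ker wB wB' Xlty.
rewrite -/l in Xlty *; set S := rsum _ _ => hS.
have SB : S <= B.
  apply: (le_trans (ler_norm _)).
  apply: rsum_norm_le; apply: le_trans HB; apply: le_esum => g _; rewrite lee_fin.
  apply: (le_trans (ler_normB _ _)); rewrite !normrM lerD// ler_piMr// ler_norml.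
    by rewrite cos_geN1 cos_le1.
  by rewrite sin_geN1 sin_le1.
have Xfin : m (strip_box H l s) \is a fin_num by rewrite ge0_fin_numE.
rewrite -(fineK Xfin) lee_fin; apply: (le_trans hS).
have -> : (4 * K)^-1 * (K * E) = E / 4 by field; rewrite gt_eqF.
have -> : 4 * B + a / 2 * (1 + `|s| / l) ^+ q = 2 * B + E / 2 by rewrite /E; field.
lra.
Qed.

Lemma nu_local_bound (l D : R) : 0 < l -> 0 <= D ->
  (forall s, (m (strip_box H l s) <= D%:E)%E) ->
  (forall z, Normc.normc (h z) = 1) ->
  exists2 C : R, 0 <= C & forall t : R,
    (nu Gamma b [set x | (t - 1 < x < t + 1)%R] <= (C * expR (4 * pi * H * `|t|))%:E)%E.
Proof.
move=> l0 D0 hm hn.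
have h1 z : `|complex.Re (h z)| <= 1 by rewrite -(hn z) normc_ge_Re.
have h2 z : `|complex.Im (h z)| <= 1 by rewrite -(hn z) normc_ge_Im.
have [psi [spsi psi0 psi1 supp0]] := @smooth_bump R.
have supp_psi : supp_in (- 2) 2 psi.
  by move=> t tab; apply: supp0; rewrite lter_normr; case/orP: tab => ?; apply/orP;
     [right|left]; lra.
have m20 : 0 < 2 :> R by [].
have [C C0 HC] := fourier_decay H 1 m20 spsi supp_psi.
have [K K0 HK] := weight_integral 0 l0.
(* Translation boundedness is the case [q = 0], [a = 0] of the hypothesis of [weight_integral]. *)
have hm' s : (m (strip_box H l s) <= (D + 0 * (1 + `|s| / l) ^+ 0)%:E)%E.
  by rewrite mul0r addr0.
pose Kb := 2 * C * (K * D).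
have Kb0 : 0 <= Kb by rewrite !mulr_ge0// ltW.
exists (2 * Kb ^+ 2); first by rewrite mulr_ge0// sqr_ge0.
move=> t; set e := expR (2 * pi * H * `|t|).
have e_ge0 : 0 <= e by exact: expR_ge0.
pose f x := psi (x - t).
have sf : smooth f by exact: smooth_shift.
have cf := smooth_continuous sf.
have sup : supp_in (t + - 2) (t + 2) f by exact: supp_in_shift.
(* [k1] and [k2] stand for the real and imaginary parts of [h] up to order and sign, so one estimate
   covers both parts of the tested integral. *)
have bound (k1 k2 : (R * R)%type -> R) u : measurable_fun setT k1 -> measurable_fun setT k2 ->
    (forall z, `|k1 z| <= 1) -> (forall z, `|k2 z| <= 1) ->
    `|\int[m]_z (fcos f (z.1 - u) z.2 * k1 z + fsin f (z.1 - u) z.2 * k2 z)| <= Kb * e.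
  move=> mk1 mk2 k11 k21.
  have wB := HK m H l D 0 l0 D0 (lexx 0) mN hm' u.
  rewrite divff ?gt_eqF// mul0r addr0 in wB.
  have -> : Kb * e = 2 * C * e * (K * D) by rewrite /Kb; ring.
  apply: (proj2 (strip_integral_le mN _ _ _ wB)).
  - apply: measurable_funD; apply: measurable_funM => //.
      exact: measurable_fcos.
    exact: measurable_fsin.
  - by rewrite !mulr_ge0.
  move=> z zH; have [d1 d2] := HC t (z.1 - u) z.2 zH.
  rewrite -/e -/f in d1 d2; apply: (le_trans (ler_normD _ _)); rewrite !normrM.
  have -> : 2 * C * e * wgt 1 1 u z = C * e / (1 + (z.1 - u) ^+ 2) ^+ 1 * 1 +
     C * e / (1 + (z.1 - u) ^+ 2) ^+ 1 * 1 by rewrite /wgt mul1r; ring.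
  by apply: lerD; apply: ler_pM.
have [B B0 HB] := summable_coef cf sup.
have Kbe : 0 <= Kb * e by rewrite mulr_ge0.
have dfin : (\esum_(g in Gamma) (`|al f g| + `|be f g|)%:E < +oo)%E.
  by apply: le_lt_trans HB _; exact: ltry.
have bRe u : `|rsum Gamma (fun g => al f g * cos (2 * pi * u * g) -
    be f g * sin (2 * pi * u * g))| <= Kb * e.
  by rewrite -(transform_Re _ sf sup); exact: bound.
have bIm u : `|rsum Gamma (fun g => al f g * sin (2 * pi * u * g) +
    be f g * cos (2 * pi * u * g))| <= Kb * e.
  rewrite -(transform_Im _ sf sup).
  have -> : \int[m]_z (fcos f (z.1 - u) z.2 * complex.Im (h z) -
      fsin f (z.1 - u) z.2 * complex.Re (h z)) = \int[m]_z (fcos f (z.1 - u) z.2 *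
      complex.Im (h z) + fsin f (z.1 - u) z.2 * - complex.Re (h z)).
    by apply: eq_Rintegral => z _; rewrite mulrN.
  apply: (bound (fun z => complex.Im (h z)) (fun z => - complex.Re (h z))) => //.
    exact: (measurableT_comp (@oppr_measurable R setT) mh1).
  by move=> z; rewrite normrN.
have bes := bessel_bound Kbe dfin bRe bIm.
rewrite /nu; apply: esum_le_seq => r ur rG.
have -> : 2 * Kb ^+ 2 * expR (4 * pi * H * `|t|) = 2 * (Kb * e) ^+ 2.
  by rewrite expR_4pi -/e; ring.
apply: le_trans (bes r ur _); last by move=> g /rG[].
rewrite !big_seq; apply: ler_sum => g gr; have [_ /= gt] := rG g gr.
rewrite /al /be !exprMn -mulrDl normc_sqr ler_peMr ?addr_ge0 ?sqr_ge0//.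
by rewrite exprn_ege1// /f psi1// ltr_norml; lra.
Qed.

End Transform.

(** * From windows of radius 1 to exponential type *)

Lemma nu_subset (Gamma : set R) (b : R -> R[i]) (A B : set R) : A `<=` B ->
  (nu Gamma b A <= nu Gamma b B)%E.
Proof.
move=> AB; apply: ereal_sup_le => _ [F [finF FA] <-]; exists F => //; split => //.
by move=> g /FA[? /AB].
Qed.

Lemma nu_setU (Gamma : set R) (b : R -> R[i]) (A B : set R) :
  (nu Gamma b (A `|` B) <= nu Gamma b A + nu Gamma b B)%E.
Proof.
rewrite {1}/nu (esumID A); last by move=> g _; rewrite lee_fin sqr_ge0.
apply: leeD; apply: ereal_sup_le => _ [F [finF FA] <-]; exists F => //; split => //.
  by move=> g /FA[[]].
by move=> g /FA[[? [//|]]].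
Qed.

(** The ball is covered by the [2 n + 1] overlapping windows centred at the integers of absolute
    value at most [n]; each induction step adds the two outermost. *)
Lemma nu_ball_bound (Gamma : set R) (b : R -> R[i]) (C c : R) (n : nat) : 0 <= C -> 0 <= c ->
  (forall t : R, (nu Gamma b [set x | (t - 1 < x < t + 1)%R] <= (C * expR (c * `|t|))%:E)%E) ->
  (nu Gamma b [set x | (`|x| < n.+1%:R)%R] <= ((2 * n%:R + 1) * C * expR (c * n%:R))%:E)%E.
Proof.
move=> C0 c0 Hnu; elim: n => [|n IH].
  have -> : (2 * 0%:R + 1) * C * expR (c * 0%:R) = C * expR (c * `|0 : R|).
    by rewrite normr0 (mulr0 2) add0r mul1r.
  apply: le_trans (Hnu 0); apply: nu_subset => x /=; rewrite ltr_norml; lra.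
apply: (@le_trans _ _ (nu Gamma b ([set x | (`|x| < n.+1%:R)%R] `|`
   ([set x | (n.+1%:R - 1 < x < n.+1%:R + 1)%R] `|`
    [set x | (- n.+1%:R - 1 < x < - n.+1%:R + 1)%R])))).
  apply: nu_subset => x /=; rewrite -[n.+2%:R]natr1 => xn.
  have [|xn'] := ltP `|x| n.+1%:R; first by left.
  right; have [x0|x0] := leP 0 x.
    by left; rewrite (ger0_norm x0) in xn xn'; lra.
  by right; rewrite (ltr0_norm x0) in xn xn'; lra.
apply: (le_trans (nu_setU _ _ _ _)).
apply: (le_trans (leeD IH (nu_setU _ _ _ _))).
apply: (le_trans (leeD (lexx _) (leeD (Hnu _) (Hnu _)))).
rewrite normrN normr_nat -!EFinD lee_fin.
have ee : expR (c * n%:R) <= expR (c * n.+1%:R) by rewrite ler_expR ler_wpM2l// ler_nat.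
have : (2 * n%:R + 1) * C * expR (c * n%:R) <= (2 * n%:R + 1) * C * expR (c * n.+1%:R).
  by rewrite ler_wpM2l// mulr_ge0// addr_ge0// mulr_ge0.
have -> : (2 * n.+1%:R + 1) * C * expR (c * n.+1%:R) =
   (2 * n%:R + 1) * C * expR (c * n.+1%:R) +
   (C * expR (c * n.+1%:R) + C * expR (c * n.+1%:R)) by rewrite -natr1; ring.
lra.
Qed.

(** The linear number of windows is absorbed by [exp (eps r)]. An eventual bound for every [eps]
    expresses the limsup without the logarithm of a quantity that may be 0. *)
Lemma nu_type (Gamma : set R) (b : R -> R[i]) (C c : R) : 0 <= C -> 0 <= c ->
  (forall t : R, (nu Gamma b [set x | (t - 1 < x < t + 1)%R] <= (C * expR (c * `|t|))%:E)%E) ->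
  forall eps : R, 0 < eps -> \forall r \near +oo,
    (nu Gamma b [set x | (- r < x < r)%R] <= (expR ((c + eps) * r))%:E)%E.
Proof.
move=> C0 c0 Hnu eps eps0; near=> r.
have r0 : 1 <= r by near: r; exact: nbhs_pinfty_ge.
(* For such [r], [(2 n + 1) C <= 3 r C] is at most [(eps r)^2 / 2], a term of the exponential
   series. *)
have rC : 12 * C / eps ^+ 2 <= r by near: r; apply: nbhs_pinfty_ge; exact: num_real.
have r_ge0 : 0 <= r by lra.
have := Num.Theory.truncn_itv r_ge0; set n := Num.truncn r => /andP[nr rn].
apply: (@le_trans _ _ (nu Gamma b [set x | (`|x| < n.+1%:R)%R])).
  by apply: nu_subset => x /=; rewrite ltr_norml; lra.
apply: (le_trans (nu_ball_bound n C0 c0 Hnu)); rewrite lee_fin.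
rewrite (mulrDl c) expRD [leLHS]mulrC; apply: ler_pM; rewrite ?expR_ge0//.
- by rewrite mulr_ge0// addr_ge0// mulr_ge0.
- by rewrite ler_expR ler_wpM2l.
apply: (@le_trans _ _ (3 * r * C)); first by rewrite ler_wpM2r//; lra.
have er0 : 0 <= eps * r by rewrite mulr_ge0// ltW.
have := expR_ge1Dxn 1 er0; rewrite (_ : 2`! = 2%N)// => h.
apply: le_trans h; apply: (@le_trans _ _ ((eps * r) ^+ 2 / 2)); last by rewrite lerDr.
move: rC; rewrite ler_pdivrMr ?exprn_gt0// => rC.
have := ler_wpM2l r_ge0 rC.
rewrite exprMn [r ^+ 2]expr2; nra.
Unshelve. all: by end_near. Qed.

End Assembly.

Theorem theorem2 (R : realType) (H : R) (m : {measure set (R * R)%type -> \bar R})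
  (h : (R * R)%type -> R[i]) (Gamma : set R) (b : R -> R[i]) :
  0 < H ->
  (* support of mu in S_H (z = (Re z, Im z)) *)
  m [set z | H < `|z.2|] = 0%E ->
  (* mu = h d m with m = |mu| and |h| = 1 (polar decomposition) *)
  measurable_fun setT (fun z => complex.Re (h z)) ->
  measurable_fun setT (fun z => complex.Im (h z)) ->
  (* case (a): mu positive with polynomial growth; case (b): complex, translation bounded *)
  ((forall z, h z = 1) /\
     exists C0 rho : R, 0 < C0 /\ 0 < rho /\
       forall r : R, 0 < r ->
         (m [set z | (`|z.1| <= r)%R /\ (`|z.2| <= H)%R] <= (C0 * Num.max 1 (r `^ rho))%:E)%E)
  \/
  ((forall z, Normc.normc (h z) = 1) /\
     exists C : R, forall s : R,
       (m [set z | (s <= z.1 <= s + 1)%R /\ (`|z.2| <= H)%R] <= C%:E)%E) ->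
  (* hat mu^c = sum_{g in Gamma} b_g delta_g is a pure point measure *)
  countable Gamma ->
  (forall K : R, (\esum_(g in Gamma `&` [set g | (`|g| <= K)%R]) (Normc.normc (b g))%:E < +oo)%E) ->
  (forall phi : R -> R[i], test_fun phi ->
     cint m (fun z => fourier_c phi z.1 z.2 * h z) =
     csum Gamma (fun g => b g * phi g)) ->
  (* conclusion *)
  (exists C T : R, forall t : R, T <= `|t| ->
      (nu Gamma b [set x | (t - 1 < x < t + 1)%R] <= (C * expR (4 * pi * H * `|t|))%:E)%E) /\
  (forall eps : R, 0 < eps ->
      \forall r \near +oo,
        (nu Gamma b [set x | (- r < x < r)%R] <= (expR ((4 * pi * H + eps) * r))%:E)%E).
Proof.
move=> H0 mN mh1 mh2 cases _ bfin Hid.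
have hn z : Normc.normc (h z) = 1.
  by case: cases => -[-> // _]; rewrite /= expr0n /= addr0 expr1n sqrtr1.
have [l [D [l0 D0 hm]]] : exists l D : R,
    [/\ 0 < l, 0 <= D & forall s, (m (strip_box H l s) <= D%:E)%E].
  case: cases => [[h1 growth]|[_ [C HC]]].
    exact: (translation_bounded_of_positive H0 mN bfin Hid h1 growth).
  exists 1, C; split => //; rewrite -lee_fin; exact: le_trans (HC 0).
have [C C0 HC] := nu_local_bound mN mh1 mh2 bfin Hid l0 D0 hm hn.
split; first by exists C, 0 => t _.
move=> eps eps0; apply: (nu_type C0 _ HC) => //.
by rewrite !mulr_ge0 ?pi_ge0// ltW.
Qed.
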